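(* Let $K$ be a field of characteristic different from $2$, let $n\geq 1$, and let $(Q_1,J_1),\dots,(Q_n,J_n)$ be quaternion algebras over $K$ with involutions of the first kind. Then there exist a quadratic space $(V,q)$ over $K$ of dimension $2n$ and an orthogonal symmetry $\sigma:V\to V$ of $(V,q)$ such that, as algebras with involution, $$(C(V,q),J_q^\sigma)\simeq (Q_1,J_1)\otimes\cdots\otimes(Q_n,J_n).$$
   Context: A quadratic space $(V,q)$ over $K$ is a finite dimensional $K$-vector space $V$ with a quadratic form $q$; $b_q(x,y)=\frac12(q(x+y)-q(x)-q(y))$. $C(V,q)$ is the Clifford algebra $T(V)/(x\otimes x-q(x)\cdot 1: x\in V)$, with canonical injection $i_q:V\to C(V,q)$. An involution is an anti-automorphism whose square is the identity; an involution of a central simple $K$-algebra is of the first kind if it fixes $K$ elementwise. An orthogonal symmetry of $(V,q)$ is a linear map $s:V\to V$ with $b_q(sx,sy)=b_q(x,y)$ for all $x,y$ and $s^2=\mathrm{id}$. For such $s$, $J_q^s$ denotes the unique $K$-linear involution of $C(V,q)$ with $J_q^s(i_q(x))=i_q(s(x))$ for all $x\in V$. Tensor products are over $K$. An isomorphism of algebras with involution is a $K$-algebra isomorphism commuting with the involutions. *)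

(* Defs.v *)
From HB Require Import structures.
From mathcomp Require Import all_boot all_order all_algebra all_field.
From mathcomp Require Import boolp.
From mathcomp Require Import finmap monalg.

Set Implicit Arguments.
Unset Strict Implicit.
Unset Printing Implicit Defensive.

Import GRing.Theory.
Local Open Scope ring_scope.
Local Open Scope quotient_scope.

(* No structure of [algType] is put on the quotient, because the library's
   algebras satisfy [1 != 0]; [alg_quot_scalerAl] and [alg_quot_scalerAr]
   complete the ring and module structures. *)
Section IdealQuotient.
Variables (K : fieldType) (A : algType K) (S : A -> Prop).

(* The two-sided ideal generated by [S]; stability under opposites and
   scaling follows from [c *: x = (c *: 1) * x]. *)
Inductive ideal_gen : A -> Prop :=
  | ideal_gen_sub x : S x -> ideal_gen x
  | ideal_gen0 : ideal_gen 0
  | ideal_genD x y : ideal_gen x -> ideal_gen y -> ideal_gen (x + y)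
  | ideal_genMl a x : ideal_gen x -> ideal_gen (a * x)
  | ideal_genMr a x : ideal_gen x -> ideal_gen (x * a).

Lemma ideal_genN x : ideal_gen x -> ideal_gen (- x).
Proof. by move=> Ix; rewrite -mulN1r; apply: ideal_genMl. Qed.

Lemma ideal_genB x y : ideal_gen x -> ideal_gen y -> ideal_gen (x - y).
Proof. by move=> Ix Iy; apply: ideal_genD => //; apply: ideal_genN. Qed.

Lemma ideal_genZ c x : ideal_gen x -> ideal_gen (c *: x).
Proof.
by move=> Ix; rewrite -[x]mul1r scalerAl; apply: ideal_genMl.
Qed.

Definition eqmod_ideal (x y : A) : bool := `[< ideal_gen (x - y) >].

Lemma eqmod_ideal_equiv : equiv_class_of eqmod_ideal.
Proof.
have sym x y : eqmod_ideal x y -> eqmod_ideal y x.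
  by move=> /asboolP Ixy; apply/asboolP; rewrite -opprB; apply: ideal_genN.
split=> [x|x y|y x z].
- by apply/asboolP; rewrite subrr; apply: ideal_gen0.
- by apply/idP/idP; apply: sym.
- move=> /asboolP Ixy /asboolP Iyz; apply/asboolP.
  by rewrite -[x](subrK y) -addrA; apply: ideal_genD.
Qed.

Canonical eqmod_ideal_equivRel := EquivRelPack eqmod_ideal_equiv.

Definition alg_quot : Type := {eq_quot eqmod_ideal_equivRel}.
HB.instance Definition _ := Choice.on alg_quot.
HB.instance Definition _ := EqQuotient.on alg_quot.

Definition to_quot (x : A) : alg_quot := \pi_alg_quot x.

Lemma to_quotP x y : to_quot x = to_quot y <-> ideal_gen (x - y).
Proof.
rewrite /to_quot; split=> [/eqmodP/asboolP//|Ixy].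
by apply/eqmodP/asboolP.
Qed.

Lemma alg_quot_ind (P : alg_quot -> Prop) :
  (forall x, P (to_quot x)) -> forall u, P u.
Proof. by move=> Px u; rewrite -[u]reprK; apply: Px. Qed.

Lemma ideal_gen_repr x : ideal_gen (repr (to_quot x) - x).
Proof. by apply/to_quotP; rewrite /to_quot reprK. Qed.

Definition alg_quot_add (u v : alg_quot) := to_quot (repr u + repr v).
Definition alg_quot_opp (u : alg_quot) := to_quot (- repr u).
Definition alg_quot_mul (u v : alg_quot) := to_quot (repr u * repr v).
Definition alg_quot_scale (c : K) (u : alg_quot) := to_quot (c *: repr u).

Lemma alg_quot_addE x y :
  alg_quot_add (to_quot x) (to_quot y) = to_quot (x + y).
Proof.
by apply/to_quotP; rewrite opprD addrACA; apply: ideal_genD;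
  apply: ideal_gen_repr.
Qed.

Lemma alg_quot_oppE x : alg_quot_opp (to_quot x) = to_quot (- x).
Proof.
by apply/to_quotP; rewrite -opprD; apply/ideal_genN/ideal_gen_repr.
Qed.

Lemma alg_quot_mulE x y :
  alg_quot_mul (to_quot x) (to_quot y) = to_quot (x * y).
Proof.
apply/to_quotP; set x' := repr _; set y' := repr _.
have -> : x' * y' - x * y = (x' - x) * y' + x * (y' - y).
  by rewrite mulrBl mulrBr addrA subrK.
by apply: ideal_genD; [apply: ideal_genMr | apply: ideal_genMl];
  apply: ideal_gen_repr.
Qed.

Lemma alg_quot_scaleE c x : alg_quot_scale c (to_quot x) = to_quot (c *: x).
Proof.
by apply/to_quotP; rewrite -scalerBr; apply/ideal_genZ/ideal_gen_repr.
Qed.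

Let quotE := (alg_quot_addE, alg_quot_oppE, alg_quot_mulE, alg_quot_scaleE).

Fact alg_quot_addA : associative alg_quot_add.
Proof. by do 3![elim/alg_quot_ind => ?]; rewrite !quotE addrA. Qed.
Fact alg_quot_addC : commutative alg_quot_add.
Proof. by do 2![elim/alg_quot_ind => ?]; rewrite !quotE addrC. Qed.
Fact alg_quot_add0 : left_id (to_quot 0) alg_quot_add.
Proof. by elim/alg_quot_ind => ?; rewrite !quotE add0r. Qed.
Fact alg_quot_addN : left_inverse (to_quot 0) alg_quot_opp alg_quot_add.
Proof. by elim/alg_quot_ind => ?; rewrite !quotE addNr. Qed.
HB.instance Definition _ := GRing.isZmodule.Build alg_quot
  alg_quot_addA alg_quot_addC alg_quot_add0 alg_quot_addN.

Lemma to_quotD : {morph to_quot : x y / x + y}.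
Proof. by move=> x y; rewrite -alg_quot_addE. Qed.

Fact alg_quot_mulA : associative alg_quot_mul.
Proof. by do 3![elim/alg_quot_ind => ?]; rewrite !quotE mulrA. Qed.
Fact alg_quot_mul1l : left_id (to_quot 1) alg_quot_mul.
Proof. by elim/alg_quot_ind => ?; rewrite !quotE mul1r. Qed.
Fact alg_quot_mul1r : right_id (to_quot 1) alg_quot_mul.
Proof. by elim/alg_quot_ind => ?; rewrite !quotE mulr1. Qed.
Fact alg_quot_mulDl : left_distributive alg_quot_mul +%R.
Proof.
by do 3![elim/alg_quot_ind => ?]; rewrite -to_quotD !quotE mulrDl to_quotD.
Qed.
Fact alg_quot_mulDr : right_distributive alg_quot_mul +%R.
Proof.
by do 3![elim/alg_quot_ind => ?]; rewrite -to_quotD !quotE mulrDr to_quotD.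
Qed.
HB.instance Definition _ := GRing.Zmodule_isPzRing.Build alg_quot
  alg_quot_mulA alg_quot_mul1l alg_quot_mul1r alg_quot_mulDl alg_quot_mulDr.

Fact alg_quot_scaleA a b u :
  alg_quot_scale a (alg_quot_scale b u) = alg_quot_scale (a * b) u.
Proof. by elim/alg_quot_ind: u => ?; rewrite !quotE scalerA. Qed.
Fact alg_quot_scale1 : left_id 1 alg_quot_scale.
Proof. by elim/alg_quot_ind => ?; rewrite !quotE scale1r. Qed.
Fact alg_quot_scaleDr : right_distributive alg_quot_scale +%R.
Proof.
move=> c; do 2![elim/alg_quot_ind => ?].
by rewrite -to_quotD !quotE scalerDr to_quotD.
Qed.
Fact alg_quot_scaleDl u : {morph alg_quot_scale^~ u : a b / a + b}.
Proof.
by elim/alg_quot_ind: u => ? a b /=; rewrite !quotE scalerDl to_quotD.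
Qed.
HB.instance Definition _ := GRing.Zmodule_isLmodule.Build K alg_quot
  alg_quot_scaleA alg_quot_scale1 alg_quot_scaleDr alg_quot_scaleDl.

Lemma to_quotM : {morph to_quot : x y / x * y}.
Proof. by move=> x y; rewrite -alg_quot_mulE. Qed.
Lemma to_quotZ c x : to_quot (c *: x) = c *: to_quot x.
Proof. by rewrite -alg_quot_scaleE. Qed.
Lemma to_quot1 : to_quot 1 = 1. Proof. by []. Qed.

Fact alg_quot_scalerAl (c : K) (u v : alg_quot) : c *: (u * v) = (c *: u) * v.
Proof.
elim/alg_quot_ind: u => x; elim/alg_quot_ind: v => y.
by rewrite -to_quotM -!to_quotZ -to_quotM scalerAl.
Qed.
Fact alg_quot_scalerAr (c : K) (u v : alg_quot) : c *: (u * v) = u * (c *: v).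
Proof.
elim/alg_quot_ind: u => x; elim/alg_quot_ind: v => y.
by rewrite -to_quotM -!to_quotZ -to_quotM scalerAr.
Qed.
End IdealQuotient.

Section FreeAlgebra.
Variables (K : fieldType) (X : choiceType).

Definition free_alg : Type := {malg K[{fmonom X}]}.
HB.instance Definition _ := GRing.Lalgebra.on free_alg.

Definition free_gen (x : X) : free_alg := mkmalgU (fmu x) 1.

Fact free_alg_scalerAr (c : K) (f g : free_alg) : c *: (f * g) = f * (c *: g).
Proof.
suff fC : f * malgC c = malgC c * f.
  by rewrite -[RHS]/(f * (c *: (g : {malg K[{fmonom X}]}))) -!mul_malgC;
     rewrite [RHS]mulrA fC -mulrA mul_malgC.
rewrite mul_malgC malgM_def fgmulgU malgZ_def.
by apply: eq_bigr => k _; rewrite mulrC mulm1.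
Qed.
HB.instance Definition _ := GRing.Lalgebra_isAlgebra.Build K free_alg
  free_alg_scalerAr.

Lemma free_alg_ind (P : free_alg -> Prop) :
    P 1 -> (forall x, P (free_gen x)) -> (forall f g, P f -> P g -> P (f + g)) ->
    (forall c f, P f -> P (c *: f)) -> (forall f g, P f -> P g -> P (f * g)) ->
  forall f, P f.
Proof.
move=> P1 Pgen PD PZ PM f; rewrite [f]monalgE.
apply: (big_ind P) => [|//|k _]; first by rewrite -(scale0r 1); apply: PZ.
have -> : << f@_k *g k >> = f@_k *: (<< k >> : free_alg).
  by apply/malgP => l; rewrite mcoeffZ !mcoeffU mulr_natr.
apply: PZ; case: k => s; elim: s => [|x s IHs].
  by rewrite -fmoneE; apply: P1.
have -> : << FMonom (x :: s) >> = free_gen x * (<< FMonom s >> : free_alg).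
  by rewrite /free_gen [RHS]malgM_def fgmulUU mulr1 -[mmul _ _]/(fmmul _ _)
             fmmulE fmuE.
exact: PM.
Qed.

End FreeAlgebra.

Arguments free_gen K {X} x.

Section CliffordAlgebra.
Variables (K : fieldType) (V : vectType K).

(* The tensor algebra: degree d words on the set V, modulo linearity in each
   letter, form the d-th tensor power of V. *)
Inductive tensor_rel : free_alg K V -> Prop :=
  | TensorRel (c : K) (x y : V) :
      tensor_rel
        (free_gen K (c *: x + y) - (c *: free_gen K x + free_gen K y)).

Definition tensor_alg : Type := alg_quot tensor_rel.
HB.instance Definition _ := GRing.PzRing.on tensor_alg.
HB.instance Definition _ := GRing.Lmodule.on tensor_alg.

Fact tensor_alg_nonzero1 : (1 : tensor_alg) != 0.
Proof.
(* the augmentation kills the ideal *)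
pose aug : {rmorphism {malg K[{fmonom V}]} -> K} :=
    @mcoeff {fmonom V} K mone.
have aug0 x : aug (free_gen K x) = 0.
  rewrite /aug /= mcoeffU; case: eqP => // /(congr1 (@fmonom_val V)).
  by rewrite fmuE fm1.
have augS (f : free_alg K V) : ideal_gen tensor_rel f -> aug f = 0.
  elim=> {f} [_ [c x y]||f g _ f0 _ g0|a f _ f0|a f _ f0].
  - by rewrite rmorphB rmorphD /= mcoeffZ !aug0 mulr0 addr0 subr0.
  - exact: rmorph0.
  - by rewrite rmorphD f0 g0 addr0.
  - by rewrite rmorphM f0 mulr0.
  - by rewrite rmorphM f0 mul0r.
apply/eqP => /(to_quotP tensor_rel 1 0).1; rewrite subr0 => /augS.
by rewrite rmorph1 => /eqP; rewrite oner_eq0.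
Qed.
HB.instance Definition _ := GRing.PzSemiRing_isNonZero.Build tensor_alg
  tensor_alg_nonzero1.
HB.instance Definition _ := GRing.Lmodule_isLalgebra.Build K tensor_alg
  (@alg_quot_scalerAl K (free_alg K V) tensor_rel).
HB.instance Definition _ := GRing.Lalgebra_isAlgebra.Build K tensor_alg
  (@alg_quot_scalerAr K (free_alg K V) tensor_rel).

Definition tensor_inj (x : V) : tensor_alg :=
  to_quot tensor_rel (free_gen K x).

Variable q : V -> K.

Definition polar_form (x y : V) : K := 2%:R^-1 * (q (x + y) - q x - q y).

Definition quadratic_form : Prop :=
  (forall (c : K) (x : V), q (c *: x) = c ^+ 2 * q x) /\
  bilinear_for *%R *%R polar_form.

Inductive clifford_rel : tensor_alg -> Prop :=
  | CliffordRel (x : V) :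
      clifford_rel (tensor_inj x * tensor_inj x - (q x)%:A).

Definition clifford_alg : Type := alg_quot clifford_rel.
HB.instance Definition _ := GRing.PzRing.on clifford_alg.
HB.instance Definition _ := GRing.Lmodule.on clifford_alg.

Definition clifford_inj (x : V) : clifford_alg :=
  to_quot clifford_rel (tensor_inj x).

Definition orthogonal_symmetry (s : V -> V) : Prop :=
  [/\ linear s,
      forall x y, polar_form (s x) (s y) = polar_form x y
    & forall x, s (s x) = x].

End CliffordAlgebra.

Definition involution (A : pzRingType) (J : A -> A) : Prop :=
  [/\ {morph J : x y / x + y}, J 1 = 1,
      forall x y, J (x * y) = J y * J x
    & forall x, J (J x) = x].

Definition first_kind (K : fieldType) (A : algType K) (J : A -> A) : Prop :=
  forall c : K, J c%:A = c%:A.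

(* [J] is the involution J_q^s of C(V,q); it is determined by these
   conditions, see [clifford_involution_uniq]. *)
Definition clifford_involution (K : fieldType) (V : vectType K) (q : V -> K)
    (s : V -> V) (J : clifford_alg q -> clifford_alg q) : Prop :=
  [/\ linear J, involution J
    & forall x, J (clifford_inj q x) = clifford_inj q (s x)].

Lemma clifford_involution_uniq (K : fieldType) (V : vectType K) (q : V -> K)
    (s : V -> V) (J1 J2 : clifford_alg q -> clifford_alg q) :
  clifford_involution s J1 -> clifford_involution s J2 -> J1 =1 J2.
Proof.
move=> [lin1 [D1 e1 M1 _] g1] [lin2 [D2 e2 M2 _] g2].
have Z1 c u : J1 (c *: u) = c *: J1 u.
  have z : J1 0 = 0 by apply: (addrI (J1 0)); rewrite -D1 !addr0.
  by rewrite -[c *: u]addr0 lin1 z addr0.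
have Z2 c u : J2 (c *: u) = c *: J2 u.
  have z : J2 0 = 0 by apply: (addrI (J2 0)); rewrite -D2 !addr0.
  by rewrite -[c *: u]addr0 lin2 z addr0.
elim/alg_quot_ind => t; elim/alg_quot_ind: t => t.
elim/free_alg_ind: t => [|x|f g|c f|f g].
- by rewrite !to_quot1 e1 e2.
- by rewrite -[to_quot _ _]/(clifford_inj q x) g1 g2.
- by rewrite !to_quotD D1 D2 => -> ->.
- by rewrite !to_quotZ Z1 Z2 => ->.
- by rewrite !to_quotM M1 M2 => -> ->.
Qed.

(* The algebra (a, b)_K; this is the notion of quaternion algebra only in
   characteristic different from 2. *)
Definition quaternion_algebra (K : fieldType) (Q : falgType K) : Prop :=
  exists (a b : K) (i j : Q),
    [/\ a != 0, b != 0, i * i = a%:A /\ j * j = b%:A, j * i = - (i * j)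
      & basis_of fullv [:: 1; i; j; i * j]].

Section TensorProduct.
Variables (K : fieldType) (I : finType) (A : I -> falgType K).

(* A family x of elements of the A i, standing for the pure tensor of the
   x i. *)
Definition family_of : choiceType := {dffun forall i, A i}.

(* The first two families of relations cut the free algebra down to the
   algebra of the multiplicative monoid of all families, that is to the free
   vector space on the product of the A i with componentwise multiplication;
   the last one is linearity in the i-th factor. *)
Inductive tensor_prod_rel : free_alg K family_of -> Prop :=
  | TensorProdOne :
      tensor_prod_rel (free_gen K ([ffun i => 1] : family_of) - 1)
  | TensorProdMul (x y : family_of) :
      tensor_prod_rel (free_gen K ([ffun i => x i * y i] : family_of)
                       - free_gen K x * free_gen K y)
  | TensorProdLin (i : I) (c : K) (x y z : family_of) :
      z i = c *: x i + y i ->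
      (forall j, j != i -> z j = x j /\ z j = y j) ->
      tensor_prod_rel
        (free_gen K z - (c *: free_gen K x + free_gen K y)).

Definition tensor_prod : Type := alg_quot tensor_prod_rel.
HB.instance Definition _ := GRing.PzRing.on tensor_prod.
HB.instance Definition _ := GRing.Lmodule.on tensor_prod.

Definition pure_tensor (x : family_of) : tensor_prod :=
  to_quot tensor_prod_rel (free_gen K x).

(* [JT] is the tensor product of the involutions [J i]; it is determined by
   these conditions, see [tensor_involution_uniq]. *)
Definition tensor_involution (J : forall i, A i -> A i)
    (JT : tensor_prod -> tensor_prod) : Prop :=
  [/\ linear JT, involution JT
    & forall x : family_of,
        JT (pure_tensor x) = pure_tensor [ffun i => J i (x i)]].

Lemma tensor_involution_uniq (J : forall i, A i -> A i)
    (JT1 JT2 : tensor_prod -> tensor_prod) :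
  tensor_involution J JT1 -> tensor_involution J JT2 -> JT1 =1 JT2.
Proof.
move=> [lin1 [D1 e1 M1 _] g1] [lin2 [D2 e2 M2 _] g2].
have Z1 c u : JT1 (c *: u) = c *: JT1 u.
  have z : JT1 0 = 0 by apply: (addrI (JT1 0)); rewrite -D1 !addr0.
  by rewrite -[c *: u]addr0 lin1 z addr0.
have Z2 c u : JT2 (c *: u) = c *: JT2 u.
  have z : JT2 0 = 0 by apply: (addrI (JT2 0)); rewrite -D2 !addr0.
  by rewrite -[c *: u]addr0 lin2 z addr0.
elim/alg_quot_ind => t; elim/free_alg_ind: t => [|x|f g|c f|f g].
- by rewrite to_quot1 e1 e2.
- by rewrite -[to_quot _ _]/(pure_tensor x) g1 g2.
- by rewrite to_quotD D1 D2 => -> ->.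
- by rewrite to_quotZ Z1 Z2 => ->.
- by rewrite to_quotM M1 M2 => -> ->.
Qed.

End TensorProduct.

(* Main.v *)
Require Import Defs.
From HB Require Import structures.
From mathcomp Require Import all_boot all_order all_algebra all_field.
From mathcomp Require Import boolp finmap monalg ring.

Set Implicit Arguments.
Unset Strict Implicit.
Unset Printing Implicit Defensive.

Import GRing.Theory.
Local Open Scope ring_scope.

(* Each (Q_i, J_i) has anticommuting generators u_i, v_i that are eigenvectors
   of J_i: the vectors x + J x and x - J x cannot both be isotropic for the
   norm form when x is not, and the same applies inside the anticommutant of
   the first generator.  In the tensor product, the 2n elements
   w_0 ... w_(m-1) u_m and w_0 ... w_(m-1) v_m, with w_i = u_i v_i, anticommute,
   have nonzero scalar squares and are again eigenvectors of the involution
   for eigenvalues 1 or -1; they span V, on which q and sigma are diagonal.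
   The map C(V, q) -> Q_1 (x) ... (x) Q_n is bijective because the same
   construction, applied to the generators of C(V, q) with suitable scalars,
   yields commuting quaternion pairs, hence an inverse map. *)

(** * Universal properties *)

(** C(V, q) and the tensor product are given by generators and relations, and nothing is known in
    advance about their size; even 1 = 0 is not excluded. The dimension of neither is computed: maps
    in both directions come from universal properties, and the composites are the identity because
    they fix generators. Targets are plain rings with a central morphism [s] from K, so that
    converse rings are allowed too; this is how anti-automorphisms are built and compared. The
    prefix w_0 ... w_(m-1) anticommutes with the generators of index below m and commutes with the
    others, which is why it exchanges commuting and anticommuting systems. Its square is the scalar
    z_m, the product over i < m of -(u_i^2 v_i^2), which is non-zero. Repeating the construction
    multiplies by the prefix a second time, so the return needs the scalars z_m^-1. Eigenvectors
    survive the construction because reversing a product of elements that commute or anticommute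
    only costs a sign. *)

Section FreeAlgebraLift.
Variables (K : fieldType) (X : choiceType) (B : pzRingType).
Variables (s : {rmorphism K -> B}) (h : X -> B).
Hypothesis sC : forall c y, GRing.comm (s c) y.

Let ev (k : {fmonom X}) : B := \prod_(x <- k) h x.

Let lift (g : free_alg K X) : B := \sum_(k <- msupp g) s g@_k * ev k.

Let evM k l : ev (mmul k l) = ev k * ev l.
Proof. by rewrite /ev fmM big_cat. Qed.

(** Enlarging the support lets sums with different supports be compared over a common finite set. *)
Let liftEw (d : {fset {fmonom X}}) (g : free_alg K X) :
  (msupp g `<=` d)%fset -> lift g = \sum_(k <- d) s g@_k * ev k.
Proof.
move=> le; rewrite /lift (big_fset_incl _ le) //= => x _ /mcoeff_outdom ->.
by rewrite rmorph0 mul0r.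
Qed.

Let liftU c k : lift << c *g k >> = s c * ev k.
Proof. by rewrite (liftEw msuppU_le) big_seq_fset1 mcoeffUU. Qed.

Let lift_is_zmod_morphism : zmod_morphism lift.
Proof.
move=> g1 g2; set d := (msupp g1 `|` msupp g2)%fset.
rewrite !(liftEw (d := d)) ?fsubsetUl ?fsubsetUr ?msuppB_le //.
by rewrite -sumrB; apply/eq_bigr => k _; rewrite -mulrBl -rmorphB -mcoeffB.
Qed.

HB.instance Definition _ :=
  GRing.isZmodMorphism.Build (free_alg K X) B lift lift_is_zmod_morphism.

Let lift_is_monoid_morphism : monoid_morphism lift.
Proof.
split=> [|f g].
  by rewrite -[1]/(<< mone >>) liftU rmorph1 mul1r /ev fm1 big_nil.
rewrite -[f * g]/((f : {malg K[{fmonom X}]}) * g) malgME raddf_sum mulr_suml.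
apply: eq_bigr => k _; rewrite raddf_sum mulr_sumr; apply: eq_bigr => l _.
rewrite /= liftU evM rmorphM -!mulrA; congr (_ * _).
by rewrite mulrA sC mulrA.
Qed.

HB.instance Definition _ :=
  GRing.isMonoidMorphism.Build (free_alg K X) B lift lift_is_monoid_morphism.

Lemma free_alg_lift : exists F : {rmorphism free_alg K X -> B},
  (forall c, F c%:A = s c) /\ (forall x, F (free_gen K x) = h x).
Proof.
exists lift; split=> [c|x].
  have -> : c%:A = (<< c *g mone >> : free_alg K X).
    by apply/malgP => k; rewrite mcoeffZ !mcoeffU mulr_natr.
  by rewrite /= liftU /ev fm1 big_nil mulr1.
by rewrite /= liftU rmorph1 mul1r /ev fmU big_seq1.
Qed.

End FreeAlgebraLift.

Section QuotientLift.
Variables (K : fieldType) (A : algType K) (S : A -> Prop).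

(** The structure map of the quotient as a ring morphism: scaling becomes multiplication by a
    central element. It need not be injective, as the quotient may be trivial. *)
Definition quot_scalar (c : K) : alg_quot S := to_quot S c%:A.

Fact quot_scalar_is_zmod_morphism : zmod_morphism quot_scalar.
Proof.
move=> a b; apply: (addIr (quot_scalar b)); rewrite subrK -to_quotD.
by rewrite -scalerDl subrK.
Qed.
HB.instance Definition _ := GRing.isZmodMorphism.Build K (alg_quot S)
  quot_scalar quot_scalar_is_zmod_morphism.

Fact quot_scalar_is_monoid_morphism : monoid_morphism quot_scalar.
Proof.
split=> [|a b]; first by rewrite /quot_scalar scale1r.
by rewrite -to_quotM -scalerAl mul1r scalerA.
Qed.
HB.instance Definition _ := GRing.isMonoidMorphism.Build K (alg_quot S)
  quot_scalar quot_scalar_is_monoid_morphism.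

Lemma quot_scalarE c (x : alg_quot S) : c *: x = quot_scalar c * x.
Proof.
elim/alg_quot_ind: x => x.
by rewrite -to_quotZ -to_quotM -scalerAl mul1r.
Qed.

Lemma quot_scalarC c (x : alg_quot S) : GRing.comm (quot_scalar c) x.
Proof.
elim/alg_quot_ind: x => x; rewrite /GRing.comm -!to_quotM.
by rewrite -scalerAl -scalerAr mul1r mulr1.
Qed.

Variables (B : pzRingType) (F : {rmorphism A -> B}).
Hypothesis FS : forall x, S x -> F x = 0.

Let F_ideal x : ideal_gen S x -> F x = 0.
Proof.
elim=> {x} [x /FS//||x y _ Fx _ Fy|a x _ Fx|a x _ Fx].
- exact: rmorph0.
- by rewrite rmorphD Fx Fy addr0.
- by rewrite rmorphM Fx mulr0.
- by rewrite rmorphM Fx mul0r.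
Qed.

Let lift (u : alg_quot S) : B := F (repr u).

Let liftE x : lift (to_quot S x) = F x.
Proof.
apply/eqP; rewrite -subr_eq0 -rmorphB; apply/eqP/F_ideal.
exact: ideal_gen_repr.
Qed.

Let lift_is_zmod_morphism : zmod_morphism lift.
Proof.
move=> u v; apply: (addIr (lift v)); rewrite subrK.
elim/alg_quot_ind: u => x; elim/alg_quot_ind: v => y.
rewrite -[- to_quot S y]/(alg_quot_opp (to_quot S y)) alg_quot_oppE.
by rewrite -to_quotD !liftE -rmorphD subrK.
Qed.
HB.instance Definition _ :=
  GRing.isZmodMorphism.Build (alg_quot S) B lift lift_is_zmod_morphism.

Let lift_is_monoid_morphism : monoid_morphism lift.
Proof.
split=> [|u v]; first by rewrite -to_quot1 liftE rmorph1.
elim/alg_quot_ind: u => x; elim/alg_quot_ind: v => y.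
by rewrite -to_quotM !liftE rmorphM.
Qed.
HB.instance Definition _ :=
  GRing.isMonoidMorphism.Build (alg_quot S) B lift lift_is_monoid_morphism.

Lemma alg_quot_lift :
  exists G : {rmorphism alg_quot S -> B}, forall x, G (to_quot S x) = F x.
Proof. by exists lift. Qed.

End QuotientLift.

Section PresentedAlgebras.
Variables (K : fieldType) (B : pzRingType) (s : {rmorphism K -> B}).
Hypothesis sC : forall c y, GRing.comm (s c) y.

(** The relations are checked for every morphism [F] with the prescribed values, so the construction
    of the lift stays hidden. *)
Lemma free_alg_quot_lift (X : choiceType) (S : free_alg K X -> Prop)
    (h : X -> B) :
  (forall F : {rmorphism free_alg K X -> B},
     (forall c g, F (c *: g) = s c * F g) ->
     (forall x, F (free_gen K x) = h x) -> forall g, S g -> F g = 0) ->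
  exists F : {rmorphism alg_quot S -> B},
    (forall c, F (quot_scalar S c) = s c) /\
    (forall x, F (to_quot S (free_gen K x)) = h x).
Proof.
move=> hS; have [F [Fs Fh]] := free_alg_lift h sC.
have FZ c g : F (c *: g) = s c * F g.
  by rewrite -[g in LHS]mul1r scalerAl rmorphM Fs.
have [G GF] := alg_quot_lift (hS F FZ Fh).
by exists G; split=> [c|x]; rewrite GF ?Fs ?Fh.
Qed.

Lemma free_alg_quot_ext (X : choiceType) (S : free_alg K X -> Prop)
    (F G : {rmorphism alg_quot S -> B}) :
  (forall c, F (quot_scalar S c) = G (quot_scalar S c)) ->
  (forall x, F (to_quot S (free_gen K x)) = G (to_quot S (free_gen K x))) ->
  F =1 G.
Proof.
move=> eqs eqg; elim/alg_quot_ind => t.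
elim/free_alg_ind: t => [|//|f g Ef Eg|c f Ef|f g Ef Eg].
- by rewrite to_quot1 !rmorph1.
- by rewrite to_quotD !rmorphD Ef Eg.
- by rewrite to_quotZ quot_scalarE !rmorphM eqs Ef.
- by rewrite to_quotM !rmorphM Ef Eg.
Qed.

Section Clifford.
Variables (V : vectType K) (q : V -> K).

Lemma clifford_lift (h : V -> B) :
  (forall c x y, h (c *: x + y) = s c * h x + h y) ->
  (forall x, h x * h x = s (q x)) ->
  exists F : {rmorphism clifford_alg q -> B},
    (forall c, F (quot_scalar (clifford_rel q) c) = s c) /\
    (forall x, F (clifford_inj q x) = h x).
Proof.
move=> hL hq.
have [|F [Fs Fh]] := @free_alg_quot_lift _ (@tensor_rel K V) h.
  move=> F FZ Fh _ [c x y].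
  by rewrite rmorphB rmorphD FZ !Fh hL subrr.
have [|G GF] := @alg_quot_lift K (tensor_alg V) (clifford_rel q) B F.
  move=> _ [x]; rewrite rmorphB rmorphM /= !Fh hq.
  by rewrite quot_scalarE mulr1 Fs subrr.
exists G; split=> [c|x]; rewrite GF ?Fh //.
by rewrite quot_scalarE mulr1.
Qed.

Lemma clifford_ext (F G : {rmorphism clifford_alg q -> B}) :
  (forall c, F (quot_scalar (clifford_rel q) c) =
             G (quot_scalar (clifford_rel q) c)) ->
  (forall x, F (clifford_inj q x) = G (clifford_inj q x)) ->
  F =1 G.
Proof.
move=> eqs eqg; elim/alg_quot_ind => t; elim/alg_quot_ind: t => t.
elim/free_alg_ind: t => [|x|f g Ef Eg|c f Ef|f g Ef Eg].
- by rewrite !to_quot1 !rmorph1.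
- exact: eqg.
- by rewrite !to_quotD !rmorphD Ef Eg.
- by rewrite !to_quotZ quot_scalarE !rmorphM eqs Ef.
- by rewrite !to_quotM !rmorphM Ef Eg.
Qed.

End Clifford.

Section TensorProd.
Variables (I : finType) (A : I -> falgType K).

Lemma tensor_prod_lift (h : family_of A -> B) :
  h [ffun i => 1] = 1 ->
  (forall x y : family_of A, h [ffun i => x i * y i] = h x * h y) ->
  (forall i c (x y z : family_of A), z i = c *: x i + y i ->
     (forall j, j != i -> z j = x j /\ z j = y j) -> h z = s c * h x + h y) ->
  exists F : {rmorphism tensor_prod A -> B},
    (forall c, F (quot_scalar (@tensor_prod_rel K I A) c) = s c) /\
    (forall x, F (pure_tensor x) = h x).
Proof.
move=> h1 hM hL.
apply: free_alg_quot_lift => F FZ Fh _ [|x y|i c x y z zi zj].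
- by rewrite rmorphB rmorph1 Fh h1 subrr.
- by rewrite rmorphB rmorphM !Fh hM subrr.
- by rewrite rmorphB rmorphD FZ !Fh (hL i c x y z) ?subrr.
Qed.

End TensorProd.
End PresentedAlgebras.

(** * Commuting and anticommuting systems of quaternion pairs *)

Lemma signed_comm_prod (B : pzRingType) (I : Type) (r : seq I) (P : pred I)
    (F : I -> B) (a : I -> bool) (x : B) :
  (forall i, P i -> x * F i = (-1) ^+ a i * (F i * x)) ->
  x * \prod_(i <- r | P i) F i =
    \prod_(i <- r | P i) (-1) ^+ a i * (\prod_(i <- r | P i) F i * x).
Proof.
move=> xF; elim: r => [|i r IHr]; first by rewrite !big_nil !mul1r mulr1.
rewrite !big_cons; case: ifP => // /xF Fi.
rewrite [LHS]mulrA Fi -!mulrA IHr; congr (_ * _).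
rewrite !mulrA; congr (_ * _ * _).
by apply: commr_prod => j _; apply: commr_sign.
Qed.

(** Multilinearity of an ordered product; [uniq] ensures that the varying factor occurs once. It
    yields the linearity relation of the tensor product. *)
Lemma prod_linear (K : fieldType) (B : pzRingType) (s : K -> B) (I : eqType)
    (r : seq I) (i : I) (c : K) (X Y Z : I -> B) :
  (forall y, GRing.comm (s c) y) -> uniq r -> i \in r ->
  Z i = s c * X i + Y i -> (forall j, j != i -> Z j = X j /\ Z j = Y j) ->
  \prod_(j <- r) Z j = s c * \prod_(j <- r) X j + \prod_(j <- r) Y j.
Proof.
move=> sC + + Zi Zj; elim: r => [//|j r IHr] /= /andP[j_r r_uniq].
rewrite in_cons !big_cons; have [eij _|nij /= i_r] := eqVneq i j.
  have Zr W : (forall j, j != i -> Z j = W j) ->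
    \prod_(j <- r) Z j = \prod_(j <- r) W j.
    move=> ZW; apply: eq_big_seq => k k_r; apply: ZW.
    by apply: contraNneq j_r => eki; rewrite -eij -eki.
  rewrite -eij Zi mulrDl -mulrA -(Zr X) -?(Zr Y) // => k /Zj[] //.
have [ZXj ZYj] := Zj j (contra_neq (@esym _ _ _) nij).
rewrite IHr // mulrDr -ZXj -ZYj; congr (_ + _).
by rewrite mulrA -sC mulrA.
Qed.

(** Only distinct indices must commute, because [X i] already stands to the left of [Y i]. *)
Lemma prodM_pairwise_comm (B : pzRingType) (I : eqType) (r : seq I)
    (X Y : I -> B) :
  uniq r -> (forall i j, i != j -> GRing.comm (X i) (Y j)) ->
  \prod_(i <- r) (X i * Y i) = \prod_(i <- r) X i * \prod_(i <- r) Y i.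
Proof.
move=> + XY; elim: r => [|i r IHr] /=; first by rewrite !big_nil mulr1.
move=> /andP[i_r r_uniq]; rewrite !big_cons IHr // -!mulrA; congr (_ * _).
rewrite !mulrA; congr (_ * _).
rewrite big_seq_cond; apply: commr_prod => j /andP[j_r _].
by apply/commr_sym/XY; apply: contraNneq i_r => <-.
Qed.

Lemma sum_anticommuting_sqr (B : pzRingType) (I : eqType) (r : seq I)
    (X : I -> B) :
  uniq r -> (forall i j, i != j -> X i * X j = - (X j * X i)) ->
  (\sum_(i <- r) X i) * (\sum_(i <- r) X i) = \sum_(i <- r) X i * X i.
Proof.
move=> + Xac; elim: r => [|i r IHr] /=; first by rewrite !big_nil mulr0.
move=> /andP[i_r r_uniq]; rewrite !big_cons mulrDl !mulrDr IHr //.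
rewrite -!addrA; congr (_ + _); rewrite addrA -[RHS]add0r; congr (_ + _).
rewrite mulr_sumr mulr_suml -big_split big1_seq //= => j j_r.
by rewrite Xac ?addNr //; apply: contraNneq i_r => ->.
Qed.

Section Twist.
Variables (K : fieldType) (n : nat).

(** The square of the prefix of length m, since (w u v)^2 = -(w^2 u^2 v^2) for anticommuting u and
    v; see [twist_prod_sqr]. *)
Definition twist_sqr (w : 'I_n -> K) (c : 'I_2 -> 'I_n -> K) (m : 'I_n) : K :=
  \prod_(i < n | (i < m)%N) (- (w i ^+ 2 * (c 0 i * c 1 i))).

Section Ring.
Variables (B : pzRingType) (s : {rmorphism K -> B}).
Hypothesis sC : forall c y, GRing.comm (s c) y.
Implicit Types (w z : 'I_n -> K) (c : 'I_2 -> 'I_n -> K).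
Implicit Types G : 'I_2 -> 'I_n -> B.

(* For [e = false] the pairs (G 0 m, G 1 m) commute with one another, as do the
   generators of a tensor product of quaternion algebras; for [e = true] all
   elements anticommute, as do orthogonal vectors in a Clifford algebra. *)
Definition quat_system (e : bool) c G : Prop :=
  [/\ forall t m, G t m * G t m = s (c t m),
      forall m, G 1 m * G 0 m = - (G 0 m * G 1 m)
    & forall t r i m, i != m ->
        G t i * G r m = (-1) ^+ e * (G r m * G t i)].

Definition twist_fact w G (i : 'I_n) : B := s (w i) * (G 0 i * G 1 i).

(* Exchanges the two kinds of systems, see [twist_system]; it is its own inverse
   for suitable scalars, see [twistK]. *)
Definition twist w z G (t : 'I_2) (m : 'I_n) : B :=
  s (z m) * (\prod_(i < n | (i < m)%N) twist_fact w G i * G t m).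

Lemma scalar_mulACA a b (x y : B) : s a * x * (s b * y) = s (a * b) * (x * y).
Proof. by rewrite rmorphM -!mulrA; congr (_ * _); rewrite mulrA -sC mulrA. Qed.

Section System.
Variables (e : bool) (c : 'I_2 -> 'I_n -> K) (G : 'I_2 -> 'I_n -> B).
Variables (w : 'I_n -> K).
Hypothesis sysG : quat_system e c G.

Lemma ord2P (t : 'I_2) : t = 0 \/ t = 1.
Proof.
by case: t => [[|[|//]] lt_t2]; [left | right]; apply: val_inj.
Qed.

(** For distinct indices two signs [(-1) ^+ e] cancel, so both kinds of systems behave alike; for
    equal indices exactly one of the two generators contributes a sign. *)
Lemma twist_fact_comm t j i :
  G t j * twist_fact w G i = (-1) ^+ (i == j) * (twist_fact w G i * G t j).
Proof.
have [Gsq G10 Gne] := sysG.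
rewrite /twist_fact mulrA -sC -!mulrA [RHS]mulrA -commr_sign -!mulrA.
congr (_ * _); have [->|ne_ij] := eqVneq i j.
  rewrite mulN1r; case: (ord2P t) => ->.
    by rewrite G10 mulrN opprK.
  by rewrite mulrA G10 mulNr -mulrA.
rewrite mul1r mulrA Gne 1?eq_sym // -!mulrA Gne 1?eq_sym //.
by rewrite [G 0 i * ((-1) ^+ _ * _)]mulrA commr_sign -mulrA signrMK.
Qed.

Lemma twist_factC i j :
  GRing.comm (twist_fact w G i) (twist_fact w G j).
Proof.
have [->//|ne_ij] := eqVneq i j.
have GW t : GRing.comm (twist_fact w G i) (G t j).
  by rewrite /GRing.comm twist_fact_comm (negPf ne_ij) mul1r.
by apply: commrM; [apply/commr_sym/sC | apply: commrM].
Qed.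

Let Z (m : 'I_n) := \prod_(i < n | (i < m)%N) twist_fact w G i.

(** Only the factor of index j gives a sign, and it is present exactly when j < m. *)
Lemma twist_prod_comm t j m : G t j * Z m = (-1) ^+ (j < m)%N * (Z m * G t j).
Proof.
rewrite (@signed_comm_prod _ _ _ _ _ (fun i => i == j)) => [|i _]; last first.
  exact: twist_fact_comm.
congr (_ * _); have [lt_jm|le_mj] := ltnP j m.
  by rewrite (big_only1 j) ?eqxx // => i /negPf ->.
rewrite big1 // => i lt_im; case: eqP => // eij.
by rewrite eij ltnNge le_mj in lt_im.
Qed.

Lemma twist_prodC i m : GRing.comm (Z i) (Z m).
Proof.
by do 2![apply: commr_prod => ? _; apply: commr_sym]; apply: twist_factC.
Qed.

Lemma twist_fact_sqr i :
  twist_fact w G i * twist_fact w G i = s (- (w i ^+ 2 * (c 0 i * c 1 i))).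
Proof.
have [Gsq G10 _] := sysG.
rewrite /twist_fact scalar_mulACA -mulrA [G 1 i * _]mulrA G10 !mulNr !mulrN.
by rewrite -mulrA Gsq [G 0 i * _]mulrA Gsq rmorphN /= !rmorphM.
Qed.

Lemma twist_prod_sqr m : Z m * Z m = s (twist_sqr w c m).
Proof.
rewrite -prodrM_comm => [|i j _ _]; last exact: twist_factC.
by rewrite rmorph_prod; apply: eq_bigr => i _; apply: twist_fact_sqr.
Qed.

(** The prefix [Z m] commutes with the generators of index m, so its two copies meet and become a
    scalar. *)
Lemma twist_mul z t r m : twist w z G t m * twist w z G r m =
  s (z m ^+ 2 * twist_sqr w c m) * (G t m * G r m).
Proof.
rewrite /twist -/(Z m) scalar_mulACA -expr2 [in RHS]rmorphM -twist_prod_sqr.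
rewrite -!mulrA [G t m * (Z m * _)]mulrA twist_prod_comm ltnn mul1r.
by rewrite -!mulrA.
Qed.

(** For distinct indices, the generator of smaller index anticommutes with the prefix of the other,
    while the generator of larger index commutes with the shorter prefix. This single extra sign
    turns [e] into [~~ e]. *)
Lemma twist_system z :
  quat_system (~~ e) (fun t m => z m ^+ 2 * twist_sqr w c m * c t m)
    (twist w z G).
Proof.
have [Gsq G10 Gne] := sysG; split=> [t m|m|t r i m ne_im].
- by rewrite twist_mul Gsq [RHS]rmorphM.
- by rewrite !twist_mul G10 mulrN.
have key t' r' i' m' : twist w z G t' i' * twist w z G r' m' =
    s (z i' * z m') *
    ((-1) ^+ (i' < m')%N * (Z i' * Z m' * (G t' i' * G r' m'))).
  rewrite /twist -!/(Z _) scalar_mulACA -!mulrA; congr (_ * _).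
  rewrite [G t' i' * (Z _ * _)]mulrA twist_prod_comm.
  case: (i' < m')%N;
    by rewrite ?expr1 ?expr0 ?mulN1r ?mul1r ?mulNr ?mulrN -!mulrA.
rewrite !key [z m * z i]mulrC Gne // [Z m * _]twist_prodC.
move: ne_im; rewrite -val_eqE /=; case: ltngtP => //= _ _; case: e;
  by rewrite ?expr0 ?expr1 ?mulN1r ?mul1r ?mulrN ?opprK.
Qed.

(** The first condition makes both twists use the same factors, hence the same prefix [Z m]; the
    second normalises the scalar [Z m * Z m] left in front of [G t m]. *)
Lemma twistK z w' z' t m :
  (forall m, w' m * (z m ^+ 2 * twist_sqr w c m) = w m) ->
  (forall m, z' m * z m * twist_sqr w c m = 1) ->
  twist w' z' (twist w z G) t m = G t m.
Proof.
move=> ww' zz'; rewrite {1}/twist.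
under eq_bigr => i _.
  rewrite /twist_fact twist_mul mulrA -rmorphM ww' -/(twist_fact w G i); over.
rewrite -/(Z m) /twist -/(Z m) [Z m * _]mulrA -[Z m * s _]sC -mulrA.
by rewrite [Z m * _]mulrA twist_prod_sqr !mulrA -!rmorphM zz' rmorph1 mul1r.
Qed.

End System.
End Ring.

Lemma twist_morph (B B' : pzRingType) (s : {rmorphism K -> B})
    (s' : {rmorphism K -> B'}) (F : {rmorphism B -> B'}) w z
    (G : 'I_2 -> 'I_n -> B) (G' : 'I_2 -> 'I_n -> B') :
  (forall a, F (s a) = s' a) -> (forall t m, F (G t m) = G' t m) ->
  forall t m, F (twist s w z G t m) = twist s' w z G' t m.
Proof.
move=> Fs FG t m; rewrite /twist !rmorphM Fs FG rmorph_prod.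
congr (_ * (_ * _)); apply: eq_bigr => i _.
by rewrite /twist_fact !rmorphM Fs !FG.
Qed.

(** Every product formed in a twist has factors that commute or anticommute, so reversing it by [F]
    only changes a sign; [FM] is this step for two factors. *)
Lemma twist_conv (B : pzRingType) (s : {rmorphism K -> B})
    (F : {rmorphism B -> B^c}) e c w z (G : 'I_2 -> 'I_n -> B) :
  (forall a (y : B), GRing.comm (s a) y) -> quat_system s e c G ->
  (forall a, F (s a) = s a) ->
  (forall t m, exists b : bool, F (G t m) = (-1) ^+ b * G t m :> B) ->
  forall t m, exists b : bool,
    F (twist s w z G t m) = (-1) ^+ b * twist s w z G t m :> B.
Proof.
move=> sC sysG Fs FG t m.
have FM (x y : B) (a b d : bool) : x * y = (-1) ^+ a * (y * x) ->
    F x = (-1) ^+ b * x :> B -> F y = (-1) ^+ d * y :> B ->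
  exists b : bool, F (x * y) = (-1) ^+ b * (x * y) :> B.
  move=> xy Fx Fy; exists (a (+) b (+) d).
  rewrite rmorphM -[LHS]/((F y : B) * F x) Fx Fy xy.
  case: a b d {Fx Fy xy} => [] [] [];
    by rewrite ?expr1 ?expr0 ?mulN1r ?mul1r ?mulNr ?mulrN ?opprK.
have Fscal a x : (exists b : bool, F x = (-1) ^+ b * x :> B) ->
  exists b : bool, F (s a * x) = (-1) ^+ b * (s a * x) :> B.
  by move=> [b Fx]; apply: (FM _ _ false false b); rewrite ?mul1r ?sC.
have [Gsq G10 Gne] := sysG.
have FW i : exists b : bool,
    F (twist_fact s w G i) = (-1) ^+ b * twist_fact s w G i :> B.
  have [b0 FG0] := FG 0 i; have [b1 FG1] := FG 1 i.
  by apply/Fscal/(FM _ _ true b0 b1); rewrite // G10 mulN1r opprK.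
apply: Fscal; have [b1 FGb] := FG t m.
have [b2 FZ] : exists b : bool,
   F (\prod_(i < n | (i < m)%N) twist_fact s w G i) =
   (-1) ^+ b * \prod_(i < n | (i < m)%N) twist_fact s w G i :> B.
  elim: (index_enum _) => [|i r IHr].
    by rewrite !big_nil; exists false; rewrite rmorph1 mul1r.
  rewrite !big_cons; case: ifP => // _.
  have [b2 FWi] := FW i; have [b3 Fr] := IHr.
  apply: (FM _ _ false b2 b3) => //; rewrite mul1r.
  by apply: commr_prod => j _; apply: twist_factC sysG _ _.
apply: (FM _ _ false b2 b1) => //.
by rewrite mul1r (twist_prod_comm sC _ sysG) ltnn mul1r.
Qed.


End Twist.

(** * Quaternion algebras *)

Section QuaternionCombinations.
Variables (K : fieldType) (B : pzRingType) (s : {rmorphism K -> B}).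
Hypothesis sC : forall c y, GRing.comm (s c) y.

(** Formal coordinates in an arbitrary ring: one multiplication table then serves both in the
    quaternion algebra and in the target of a lift. *)
Definition quat_comb (u v : B) (x0 x1 x2 x3 : K) : B :=
  s x0 + s x1 * u + s x2 * v + s x3 * (u * v).

Variables (a b : K) (u v : B).
Hypotheses (uu : u * u = s a) (vv : v * v = s b) (vu : v * u = - (u * v)).
Local Notation qt := (quat_comb u v).

Lemma quat_combD x0 x1 x2 x3 y0 y1 y2 y3 :
  qt x0 x1 x2 x3 + qt y0 y1 y2 y3 =
  qt (x0 + y0) (x1 + y1) (x2 + y2) (x3 + y3).
Proof.
rewrite /quat_comb !rmorphD !mulrDl.
by do 2![rewrite addrACA; congr (_ + _)]; apply: addrACA.
Qed.

Lemma quat_combZ c x0 x1 x2 x3 :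
  s c * qt x0 x1 x2 x3 = qt (c * x0) (c * x1) (c * x2) (c * x3).
Proof. by rewrite /quat_comb !rmorphM !mulrDr !mulrA. Qed.

Lemma quat_comb_mulu x0 x1 x2 x3 :
  u * qt x0 x1 x2 x3 = qt (a * x1) x0 (a * x3) x2.
Proof.
have E c y : u * (s c * y) = s c * (u * y) by rewrite mulrA -sC mulrA.
rewrite /quat_comb !mulrDr !E -(sC x0) [u * (u * v)]mulrA uu.
rewrite (mulrC a) (mulrC a) !rmorphM -!mulrA.
by rewrite [s x0 * u + _]addrC addrAC.
Qed.

Lemma quat_comb_mulv x0 x1 x2 x3 :
  v * qt x0 x1 x2 x3 = qt (b * x2) (- (b * x3)) x0 (- x1).
Proof.
have E c y : v * (s c * y) = s c * (v * y) by rewrite mulrA -sC mulrA.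
rewrite /quat_comb !mulrDr !E -(sC x0) [v * (u * v)]mulrA vu vv mulNr.
rewrite -[u * v * v]mulrA vv -(sC b u) (mulrC b) (mulrC b) !rmorphN !rmorphM.
rewrite !mulNr !mulrN -!mulrA.
by rewrite -addrA addrC addrA.
Qed.

Lemma quat_combM x0 x1 x2 x3 y0 y1 y2 y3 :
  qt x0 x1 x2 x3 * qt y0 y1 y2 y3 =
  qt (x0 * y0 + a * x1 * y1 + b * x2 * y2 - a * b * x3 * y3)
     (x0 * y1 + x1 * y0 - b * x2 * y3 + b * x3 * y2)
     (x0 * y2 + a * x1 * y3 + x2 * y0 - a * x3 * y1)
     (x0 * y3 + x1 * y2 - x2 * y1 + x3 * y0).
Proof.
rewrite {1}/quat_comb !mulrDl -!mulrA !(quat_comb_mulu, quat_comb_mulv).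
rewrite !quat_combZ !quat_combD.
by congr (qt _ _ _ _); ring.
Qed.

Lemma quat_comb_scalar c : s c = qt c 0 0 0.
Proof. by rewrite /quat_comb !rmorph0 !mul0r !addr0. Qed.

Lemma quat_combN x0 x1 x2 x3 :
  - qt x0 x1 x2 x3 = qt (- x0) (- x1) (- x2) (- x3).
Proof. by rewrite /quat_comb !rmorphN !mulNr !opprD. Qed.

Lemma quat_combu : u = qt 0 1 0 0.
Proof. by rewrite /quat_comb !rmorph0 rmorph1 !mul0r mul1r !addr0 add0r. Qed.

Lemma quat_combv : v = qt 0 0 1 0.
Proof. by rewrite /quat_comb !rmorph0 rmorph1 !mul0r mul1r !addr0 !add0r. Qed.

Lemma quat_comb_mulru x0 x1 x2 x3 :
  qt x0 x1 x2 x3 * u = qt (a * x1) x0 (- (a * x3)) (- x2).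
Proof. by rewrite {2}quat_combu quat_combM; congr (qt _ _ _ _); ring. Qed.

Lemma quat_comb_mulrv x0 x1 x2 x3 :
  qt x0 x1 x2 x3 * v = qt (b * x2) (b * x3) x0 x1.
Proof. by rewrite {2}quat_combv quat_combM; congr (qt _ _ _ _); ring. Qed.

Hypotheses (K2 : (2%:R : K) != 0) (a0 : a != 0) (b0 : b != 0).
Hypothesis s_inj : injective s.

(* Conjugation by [u], then by [v], cancels the other three coordinates. *)
Let quat_comb_eq0_fst x0 x1 x2 x3 : qt x0 x1 x2 x3 = 0 -> x0 = 0.
Proof.
move=> x_0.
have eq_u : qt (2%:R * a * x0) (2%:R * a * x1) 0 0 = 0.
  transitivity (s a * qt x0 x1 x2 x3 + u * qt x0 x1 x2 x3 * u); last first.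
    by rewrite x_0 !(mulr0, mul0r) addr0.
  rewrite quat_comb_mulu quat_comb_mulru quat_combZ quat_combD.
  by congr (qt _ _ _ _); ring.
have eq_v : qt (2%:R * b * (2%:R * a * x0)) 0 0 0 = 0.
  transitivity (s b * qt (2%:R * a * x0) (2%:R * a * x1) 0 0
     + v * qt (2%:R * a * x0) (2%:R * a * x1) 0 0 * v); last first.
    by rewrite eq_u !(mulr0, mul0r) addr0.
  rewrite quat_comb_mulv quat_comb_mulrv quat_combZ quat_combD.
  by congr (qt _ _ _ _); ring.
move: eq_v; rewrite -quat_comb_scalar -(rmorph0 s) => /s_inj/eqP.
by rewrite !mulf_eq0 (negPf K2) (negPf a0) (negPf b0) => /eqP.
Qed.

(** Left multiplication by u, by v, or by u and then v moves each remaining coordinate, up to a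
    non-zero scalar, to the first place, where it must vanish. *)
Lemma quat_comb_inj x0 x1 x2 x3 y0 y1 y2 y3 :
  qt x0 x1 x2 x3 = qt y0 y1 y2 y3 ->
  [/\ x0 = y0, x1 = y1, x2 = y2 & x3 = y3].
Proof.
move=> /eqP; rewrite -subr_eq0 quat_combN quat_combD => /eqP xy0.
have := congr1 ( *%R v) (congr1 ( *%R u) xy0).
rewrite !(quat_comb_mulu, quat_comb_mulv) !mulr0 => /quat_comb_eq0_fst e3.
have := congr1 ( *%R u) xy0; have := congr1 ( *%R v) xy0.
rewrite !(quat_comb_mulu, quat_comb_mulv) !mulr0.
move=> /quat_comb_eq0_fst e2 /quat_comb_eq0_fst e1.
have e0 := quat_comb_eq0_fst xy0.
move/eqP: e0 e1 e2 e3 => + /eqP + /eqP + /eqP.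
rewrite !mulf_eq0 (negPf a0) (negPf b0) /= !subr_eq0.
by do 4![move/eqP->].
Qed.

End QuaternionCombinations.

(** * Presentation of quaternion algebras, and generators adapted to an involution *)

Section QuaternionAlgebras.
Variables (K : fieldType) (Q : falgType K).
Hypothesis K2 : (2%:R : K) != 0.

Lemma in_algC c (y : Q) : GRing.comm (in_alg Q c) y.
Proof. by rewrite /GRing.comm /= mulr_algl mulr_algr. Qed.

Lemma in_alg_inj : injective (in_alg Q).
Proof. exact: fmorph_inj. Qed.

Local Notation qt := (quat_comb (in_alg Q)).

Definition quat_pair (a b : K) (u v : Q) : Prop :=
  [/\ a != 0, b != 0, u * u = a%:A, v * v = b%:A & v * u = - (u * v)].

Lemma quat_combE (u v : Q) x0 x1 x2 x3 :
  qt u v x0 x1 x2 x3 = x0 *: 1 + x1 *: u + x2 *: v + x3 *: (u * v).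
Proof. by rewrite /quat_comb /= !mulr_algl. Qed.

Lemma quat_comb_full (u v x : Q) : basis_of fullv [:: 1; u; v; u * v] ->
  exists x0 x1 x2 x3, x = qt u v x0 x1 x2 x3.
Proof.
move=> uv_basis; have := memvf x.
rewrite -(span_basis uv_basis) !span_cons span_nil addv0.
case/memv_addP=> _ /vlineP[x0 ->] [y1 /memv_addP[_ /vlineP[x1 ->] [y2]] + ->].
case/memv_addP=> _ /vlineP[x2 ->] [_ /vlineP[x3 ->] ->] ->.
by exists x0, x1, x2, x3; rewrite quat_combE -!addrA.
Qed.

(** Coordinates are obtained by choice and are unique by [quat_comb_inj]; the map is multiplicative
    because both rings obey the table [quat_combM]. *)
Lemma quat_lift (a b : K) (u v : Q) (B : pzRingType) (s : {rmorphism K -> B})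
    (U V : B) :
  quat_pair a b u v -> basis_of fullv [:: 1; u; v; u * v] ->
  (forall c y, GRing.comm (s c) y) ->
  U * U = s a -> V * V = s b -> V * U = - (U * V) ->
  exists F : {rmorphism Q -> B}, [/\ forall c, F c%:A = s c, F u = U & F v = V].
Proof.
move=> [a0 b0 uu vv vu] uv_basis sC UU VV VU.
have /choice[crd crdE] x : exists p : K * K * K * K,
    x = qt u v p.1.1.1 p.1.1.2 p.1.2 p.2.
  have [x0 [x1 [x2 [x3 ->]]]] := quat_comb_full x uv_basis.
  by exists (x0, x1, x2, x3).
pose F x := let p := crd x in quat_comb s U V p.1.1.1 p.1.1.2 p.1.2 p.2.
have FE x0 x1 x2 x3 : F (qt u v x0 x1 x2 x3) = quat_comb s U V x0 x1 x2 x3.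
  have /esym := crdE (qt u v x0 x1 x2 x3); rewrite /F /=.
  by case/(quat_comb_inj in_algC uu vv vu K2 a0 b0 in_alg_inj) => -> -> -> ->.
have F_zmod : zmod_morphism F.
  move=> x y; have [x0 [x1 [x2 [x3 ->]]]] := quat_comb_full x uv_basis.
  have [y0 [y1 [y2 [y3 ->]]]] := quat_comb_full y uv_basis.
  by rewrite quat_combN quat_combD !FE quat_combN quat_combD.
have F_scalar c : F c%:A = s c.
  by rewrite -[_%:A]/(in_alg Q c) (quat_comb_scalar _ u v) FE -quat_comb_scalar.
have F_monoid : monoid_morphism F.
  split=> [|x y]; first by rewrite -(scale1r 1) F_scalar rmorph1.
  have [x0 [x1 [x2 [x3 ->]]]] := quat_comb_full x uv_basis.
  have [y0 [y1 [y2 [y3 ->]]]] := quat_comb_full y uv_basis.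
  rewrite (quat_combM in_algC uu vv vu) !FE.
  by rewrite (quat_combM sC UU VV VU).
pose Fm : {rmorphism Q -> B} := HB.pack F
  (GRing.isZmodMorphism.Build Q B F F_zmod)
  (GRing.isMonoidMorphism.Build Q B F F_monoid).
exists Fm; split=> //=.
- by rewrite [u in F u](quat_combu (in_alg Q) u v) FE -quat_combu.
- by rewrite [v in F v](quat_combv (in_alg Q) u v) FE -quat_combv.
Qed.

Lemma quat_rmorphism_ext (u v : Q) (B : pzRingType) (F G : {rmorphism Q -> B}) :
  basis_of fullv [:: 1; u; v; u * v] ->
  (forall c, F c%:A = G c%:A) -> F u = G u -> F v = G v -> F =1 G.
Proof.
move=> uv_basis Fs Fu Fv x.
have [x0 [x1 [x2 [x3 ->]]]] := quat_comb_full x uv_basis.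
by rewrite /quat_comb !rmorphD !rmorphM !Fs Fu Fv.
Qed.

Lemma quat_rmorphism_comm (u v : Q) (B : pzRingType) (F : {rmorphism Q -> B})
    (y : B) :
  basis_of fullv [:: 1; u; v; u * v] ->
  (forall c, GRing.comm y (F c%:A)) -> GRing.comm y (F u) ->
  GRing.comm y (F v) -> forall x, GRing.comm y (F x).
Proof.
move=> uv_basis ys yu yv x.
have [x0 [x1 [x2 [x3 ->]]]] := quat_comb_full x uv_basis.
rewrite /quat_comb !rmorphD !rmorphM.
by do ![apply: commrD | apply: commrM | exact: ys].
Qed.

Lemma quat_pair_basis (a b : K) (u v : Q) : quat_pair a b u v ->
  \dim {: Q} = 4 -> basis_of fullv [:: 1; u; v; u * v].
Proof.
move=> [a0 b0 uu vv vu] dimQ; rewrite basisEfree dimQ /= subvf andbT /=.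
apply/(@freeP _ _ _ [tuple 1; u; v; u * v]) => k.
rewrite !big_ord_recl big_ord0 addr0 /= => k0.
have /(quat_comb_inj in_algC uu vv vu K2 a0 b0 in_alg_inj) :
    qt u v (k ord0) (k (lift ord0 ord0)) (k (lift ord0 (lift ord0 ord0)))
       (k (lift ord0 (lift ord0 (lift ord0 ord0)))) = qt u v 0 0 0 0.
  by rewrite !quat_combE !scale0r !addr0 -!addrA.
case=> k_0 k_1 k_2 k_3 i.
do 3![case: (unliftP ord0 i) => [{}i ->|-> //]].
by case: (unliftP ord0 i) => [[]//|->].
Qed.

Lemma quat_eigen_generators (J : Q -> Q) :
  quaternion_algebra Q -> involution J -> first_kind J ->
  exists (a b : K) (u v : Q), [/\ quat_pair a b u v,
    basis_of fullv [:: 1; u; v; u * v],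
    exists e : bool, J u = (-1) ^+ e * u
  & exists e : bool, J v = (-1) ^+ e * v].
Proof.
move=> [a [b [i [j [a0 b0 [ii jj] ji ij_basis]]]]] [JD J1 JM JJ] JK.
pose qij := qt i j; pose pure x := exists x1 x2 x3, x = qij 0 x1 x2 x3.
have qij_inj := quat_comb_inj in_algC ii jj ji K2 a0 b0 in_alg_inj.
have qijM := quat_combM in_algC ii jj ji.
(* The square of a pure quaternion, that is, minus its reduced norm. *)
pose nrm x1 x2 x3 := a * x1 * x1 + b * x2 * x2 - a * b * x3 * x3.
have sqr_qij x1 x2 x3 : qij 0 x1 x2 x3 * qij 0 x1 x2 x3 = (nrm x1 x2 x3)%:A.
  rewrite /qij qijM -[RHS]/(in_alg Q _) (quat_comb_scalar _ i j) /nrm.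
  by congr (quat_comb _ _ _ _ _ _ _); ring.
have pure_sqr x : pure x -> exists N, x * x = N%:A.
  by move=> [x1 [x2 [x3 ->]]]; exists (nrm x1 x2 x3); apply: sqr_qij.
have J0 : J 0 = 0 by apply: (addrI (J 0)); rewrite -JD !addr0.
have JN x : J (- x) = - J x.
  by apply/eqP; rewrite -addr_eq0 -JD addNr J0.
have J_sign (e : bool) x : J ((-1) ^+ e * x) = (-1) ^+ e * J x.
  by case: e; rewrite ?mulN1r ?mul1r ?JN.
(* The square of [J x] is a scalar, so [J x] is pure or a scalar. A non-zero scalar is excluded: it
   is fixed by [J], so x itself would be that scalar. *)
have pureJ x : pure x -> pure (J x).
  move=> x_pure; have [N xx] := pure_sqr _ x_pure.
  have JxJx : J x * J x = N%:A by rewrite -JM xx JK.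
  have [y0 [y1 [y2 [y3 Jx]]]] := quat_comb_full (J x) ij_basis.
  move: JxJx; rewrite Jx qijM -[RHS]/(in_alg Q _) (quat_comb_scalar _ i j).
  case/qij_inj=> _ e1 e2 e3; exists y1, y2, y3; congr (quat_comb _ _ _ _ _ _ _).
  have {}e1 : 2%:R * y0 * y1 = 0 by rewrite -e1; ring.
  have {}e2 : 2%:R * y0 * y2 = 0 by rewrite -e2; ring.
  have {}e3 : 2%:R * y0 * y3 = 0 by rewrite -e3; ring.
  apply/eqP; case: (eqVneq y0 0) => // y0_neq0.
  have y_eq0 y : 2%:R * y0 * y = 0 -> y = 0.
    by move/eqP; rewrite !mulf_eq0 (negPf K2) (negPf y0_neq0) => /eqP.
  move: x_pure Jx => [x1 [x2 [x3 ->]]].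
  rewrite (y_eq0 _ e1) (y_eq0 _ e2) (y_eq0 _ e3) -quat_comb_scalar => Jx.
  have := JJ (qij 0 x1 x2 x3); rewrite Jx JK -[LHS]/(in_alg Q _).
  rewrite (quat_comb_scalar _ i j) => /qij_inj[/eqP].
  by rewrite (negPf y0_neq0).
have pureD x y : pure x -> pure y -> pure (x + y).
  move=> [x1 [x2 [x3 ->]]] [y1 [y2 [y3 ->]]]; rewrite /qij quat_combD addr0.
  by exists (x1 + y1), (x2 + y2), (x3 + y3).
have pureN x : pure x -> pure (- x).
  move=> [x1 [x2 [x3 ->]]]; rewrite /qij quat_combN oppr0.
  by exists (- x1), (- x2), (- x3).
have pure_sign (e : bool) x : pure x -> pure ((-1) ^+ e * x).
  by case: e; rewrite ?mulN1r ?mul1r //; apply: pureN.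
(* [J x] has the same square as x, so the squares of [x + J x] and [x - J x] add up to four times
   that of x. *)
have sq2 x : x * x != 0 -> pure x ->
    exists e : bool, (x + (-1) ^+ e * J x) * (x + (-1) ^+ e * J x) != 0.
  move=> x0 x_pure; have [N xx] := pure_sqr _ x_pure.
  have JxJx : J x * J x = x * x by rewrite -JM xx JK.
  have [e0|] := eqVneq ((x + J x) * (x + J x)) 0; last first.
    by exists false; rewrite mul1r.
  exists true; rewrite mulN1r; apply: contra x0 => /eqP e1.
  have : (x + J x) * (x + J x) + (x - J x) * (x - J x) = (4%:R : K) *: (x * x).
    rewrite !mulrDl !mulrDr !mulrN !mulNr opprK JxJx addrACA.
    rewrite [_ + _ + (x * x - _)]addrACA subrr addr0 [_ + _ + (- _ + _)]addrACA.
    by rewrite subrr add0r scaler_nat !mulrS mulr0n addr0 !addrA.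
  rewrite e0 e1 addr0 => /esym/eqP; rewrite scaler_eq0 => /orP[|//].
  by rewrite (natrM _ 2 2) mulf_eq0 (negPf K2).
have sq_scalar x : x * x != 0 -> pure x ->
    exists2 N, N != 0 & x * x = N%:A.
  move=> x0 /pure_sqr[N xx]; exists N => //.
  by apply: contraNneq x0 => N0; rewrite xx N0 scale0r.
pose eigen (e : bool) x := x + (-1) ^+ e * J x.
have J_eigen e x : J (eigen e x) = (-1) ^+ e * eigen e x.
  by rewrite /eigen JD J_sign JJ mulrDr signrMK addrC.
have pure_eigen e x : pure x -> pure (eigen e x).
  by move=> x_pure; apply/pureD/pure_sign/pureJ.
have [u [e [u_pure uu0 Ju]]] : exists u e,
    [/\ pure u, u * u != 0 & J u = (-1) ^+ nat_of_bool e * u].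
  have i_pure : pure i by exists 1, 0, 0; apply: quat_combu.
  have [|e ee] := sq2 i _ i_pure.
    by rewrite ii scaler_eq0 negb_or a0 oner_eq0.
  by exists (eigen e i), e; split=> //; apply: pure_eigen.
have [a' a'0 uu] := sq_scalar _ uu0 u_pure.
(* The commutators of u with i, j and i * j anticommute with u, and a weighted
   sum of their squares is 8 a b (u * u). *)
have [w [w_pure w0 wu]] : exists w, [/\ pure w, w * w != 0 & w * u = - (u * w)].
  have [x1 [x2 [x3 def_u]]] := u_pure.
  have nrm0 : nrm x1 x2 x3 != 0.
    by apply: contraNneq uu0; rewrite def_u sqr_qij => ->; rewrite scale0r.
  (* The square of the commutator of u with y1 i + y2 j + y3 i j; its coordinates are a weighted
     cross product. *)
  pose c y1 y2 y3 := nrm (2%:R * b * (x3 * y2 - x2 * y3))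
    (2%:R * a * (x1 * y3 - x3 * y1)) (2%:R * (x1 * y2 - x2 * y1)).
  have [y1 [y2 [y3 cy0]]] : exists y1 y2 y3, c y1 y2 y3 != 0.
    have [c1|c1] := eqVneq (c 1 0 0) 0; last by exists 1, 0, 0.
    have [c2|c2] := eqVneq (c 0 1 0) 0; last by exists 0, 1, 0.
    exists 0, 0, 1; apply: contra nrm0 => /eqP c3.
    have /eqP : 2%:R * 2%:R * 2%:R * a * b * nrm x1 x2 x3 = 0.
      transitivity (c 0 0 1 - b * c 1 0 0 - a * c 0 1 0).
        by rewrite /c /nrm; ring.
      by rewrite c1 c2 c3 !mulr0 !subr0.
    by rewrite !mulf_eq0 (negPf K2) (negPf a0) (negPf b0).
  pose y := qij 0 y1 y2 y3; exists (u * y - y * u).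
  have wE : u * y - y * u = qij 0 (2%:R * b * (x3 * y2 - x2 * y3))
      (2%:R * a * (x1 * y3 - x3 * y1)) (2%:R * (x1 * y2 - x2 * y1)).
    rewrite def_u /y /qij !qijM quat_combN quat_combD.
    by congr (quat_comb _ _ _ _ _ _ _); ring.
  split.
  - by rewrite wE; do 3!eexists.
  - by rewrite wE sqr_qij scaler_eq0 negb_or cy0 oner_eq0.
  (* A commutator with u anticommutes with u because the square of u is central. *)
  - rewrite mulrBl mulrBr opprB -!mulrA uu [u * (u * y)]mulrA uu.
    by rewrite mulr_algl mulr_algr.
have [d vv0] := sq2 w w0 w_pure.
have [b' b'0 vv] := sq_scalar _ vv0 (pure_eigen d w w_pure).
exists a', b', u, (eigen d w).
have uv_pair : quat_pair a' b' u (eigen d w).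
  split=> //; rewrite /eigen mulrDl mulrDr wu opprD; congr (_ + _).
  (* Applying [J] to the relation between w and u, where [J u] is u up to sign, gives the same
     relation for [J w]. *)
  have : u * J w = - (J w * u).
    have := congr1 J wu; rewrite JN !JM Ju.
    case: (e); rewrite ?mulN1r ?mul1r // mulrN mulNr opprK => <-.
    by rewrite opprK.
  case: d {vv0 vv}; rewrite ?mulN1r ?mul1r ?mulNr ?mulrN => ->;
    by rewrite ?opprK.
split; [by []| | by exists e | by exists d].
by apply: (quat_pair_basis uv_pair); rewrite (size_basis ij_basis).
Qed.

End QuaternionAlgebras.

(** * Tensor products and Clifford algebras *)

Section TensorFactors.
Variables (K : fieldType) (I : finType) (A : I -> falgType K).
Local Notation T := (tensor_prod A).
Local Notation pt := (@pure_tensor K I A).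
Local Notation sT := (quot_scalar (@tensor_prod_rel K I A)).
Implicit Types (x y z : family_of A).

Lemma pure_tensor1 : pt [ffun i => 1] = 1.
Proof. by apply/to_quotP/ideal_gen_sub/TensorProdOne. Qed.

Lemma pure_tensorM x y : pt [ffun i => x i * y i] = pt x * pt y.
Proof. by rewrite -to_quotM; apply/to_quotP/ideal_gen_sub/TensorProdMul. Qed.

Lemma pure_tensor_linear i c x y z : z i = c *: x i + y i ->
  (forall j, j != i -> z j = x j /\ z j = y j) -> pt z = sT c * pt x + pt y.
Proof.
move=> zi zj; rewrite -quot_scalarE -to_quotZ -to_quotD.
by apply/to_quotP/ideal_gen_sub/(TensorProdLin zi zj).
Qed.

Definition tensor_factor (i : I) (a : A i) : T :=
  pt [ffun j => dfwith (fun j => 1 : A j) a j].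

Lemma tensor_factor_linear i c (a b : A i) :
  tensor_factor (c *: a + b) = sT c * tensor_factor a + tensor_factor b.
Proof.
apply: (@pure_tensor_linear i); first by rewrite !ffunE !dfwith_in.
by move=> j ne_ji; rewrite !ffunE !dfwith_out // eq_sym.
Qed.

Fact tensor_factor_is_zmod_morphism i : zmod_morphism (@tensor_factor i).
Proof.
move=> a b; rewrite -[a - b]addrC -scaleN1r tensor_factor_linear.
by rewrite rmorphN1 mulN1r addrC.
Qed.
HB.instance Definition _ i := GRing.isZmodMorphism.Build (A i) T
  (@tensor_factor i) (@tensor_factor_is_zmod_morphism i).

Fact tensor_factor_is_monoid_morphism i : monoid_morphism (@tensor_factor i).
Proof.
split=> [|a b].
  rewrite -pure_tensor1; congr pt; apply/ffunP => j; rewrite !ffunE.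
  by case: dfwithP.
rewrite -pure_tensorM; congr pt; apply/ffunP => j; rewrite !ffunE.
have [<-|ne_ij] := eqVneq i j; first by rewrite !dfwith_in.
by rewrite !dfwith_out ?mulr1.
Qed.
HB.instance Definition _ i := GRing.isMonoidMorphism.Build (A i) T
  (@tensor_factor i) (@tensor_factor_is_monoid_morphism i).

Lemma tensor_factor_scalar i c : tensor_factor (c%:A : A i) = sT c.
Proof.
by rewrite -[c%:A]addr0 tensor_factor_linear rmorph0 addr0 rmorph1 mulr1.
Qed.

Lemma tensor_factorC i j (a : A i) (b : A j) : i != j ->
  GRing.comm (tensor_factor a) (tensor_factor b).
Proof.
move=> ne_ij; rewrite /GRing.comm /tensor_factor -!pure_tensorM.
congr pt; apply/ffunP => k; rewrite !ffunE.
have [<-|ne_ik] := eqVneq i k.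
  by rewrite [dfwith _ b _]dfwith_out 1?eq_sym // mulr1 mul1r.
by rewrite [dfwith _ a _]dfwith_out // mulr1 mul1r.
Qed.

Lemma pure_tensor_prod x : pt x = \prod_i tensor_factor (x i).
Proof.
(* Truncated families, equal to 1 outside [r], allow induction along the enumeration of the index
   set. *)
pose part (r : seq I) : family_of A := [ffun i => if i \in r then x i else 1].
have {1}-> : x = part (index_enum I).
  by apply/ffunP => i; rewrite ffunE mem_index_enum.
elim: (index_enum I) (index_enum_uniq I) => [_|i r IHr] /=.
  by rewrite big_nil -pure_tensor1.
move=> /andP[i_r r_uniq]; rewrite big_cons -IHr // -pure_tensorM.
congr pt; apply/ffunP => j; rewrite /part !ffunE in_cons.
have [->|ne_ji] := eqVneq j i; first by rewrite dfwith_in (negPf i_r) mulr1.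
by rewrite dfwith_out 1?eq_sym // mul1r.
Qed.

(** The ordered product of the [G i (x i)] is multiplicative in x because images of different
    factors commute. *)
Lemma tensor_prod_comm_lift (B : pzRingType) (s : {rmorphism K -> B})
    (G : forall i, {rmorphism A i -> B}) :
  (forall c (b : B), GRing.comm (s c) b) -> (forall i c, G i c%:A = s c) ->
  (forall i j a b, i != j -> GRing.comm (G i a) (G j b)) ->
  exists F : {rmorphism T -> B}, (forall c, F (sT c) = s c) /\
    (forall i (a : A i), F (tensor_factor a) = G i a).
Proof.
move=> sC Gs GC; pose h (x : family_of A) := \prod_i G i (x i).
have [|||F [Fs Fh]] := @tensor_prod_lift K B s sC I A h.
- by rewrite /h big1 // => i _; rewrite ffunE rmorph1.
- move=> x y; rewrite /h -prodM_pairwise_comm ?index_enum_uniq //.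
    by apply: eq_bigr => i _; rewrite ffunE rmorphM.
  by move=> i j; apply: GC.
- move=> i k x y w wi wj; apply: (@prod_linear _ _ _ _ _ i).
  + exact: sC.
  + exact: index_enum_uniq.
  + exact: mem_index_enum.
  + by rewrite wi rmorphD -mulr_algl rmorphM Gs.
  + by move=> j /wj[-> ->].
exists F; split=> // i a; rewrite Fh /h (big_only1 i) //.
  by rewrite ffunE dfwith_in.
by move=> j ne_ji _; rewrite ffunE dfwith_out 1?eq_sym // rmorph1.
Qed.

End TensorFactors.

Section CliffordGenerators.
Variables (K : fieldType) (V : vectType K) (q : V -> K).
Local Notation sC := (quot_scalar (clifford_rel q)).

Lemma clifford_inj_linear c x y :
  clifford_inj q (c *: x + y) = sC c * clifford_inj q x + clifford_inj q y.
Proof.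
rewrite -quot_scalarE -to_quotZ -to_quotD; congr to_quot.
rewrite -to_quotZ -to_quotD.
by apply/to_quotP/ideal_gen_sub/TensorRel.
Qed.

Lemma clifford_injD x y :
  clifford_inj q (x + y) = clifford_inj q x + clifford_inj q y.
Proof. by rewrite -[x in LHS]scale1r clifford_inj_linear rmorph1 mul1r. Qed.

Lemma clifford_inj_sqr x : clifford_inj q x * clifford_inj q x = sC (q x).
Proof.
by rewrite -to_quotM; apply/to_quotP/ideal_gen_sub/CliffordRel.
Qed.

(** Additivity of q on the pair is orthogonality; in the expanded square of the sum only the cross
    terms remain. *)
Lemma clifford_inj_anticomm x y : q (x + y) = q x + q y ->
  clifford_inj q x * clifford_inj q y = - (clifford_inj q y * clifford_inj q x).
Proof.
move=> qxy; have := clifford_inj_sqr (x + y).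
rewrite clifford_injD mulrDl !mulrDr !clifford_inj_sqr qxy rmorphD.
rewrite addrA => /addIr; rewrite -addrA => /(canRL (addKr _)).
by rewrite addNr => /eqP; rewrite addr_eq0 => /eqP.
Qed.

Lemma clifford_inj0 : clifford_inj q 0 = 0.
Proof. by apply: (addrI (clifford_inj q 0)); rewrite -clifford_injD !addr0. Qed.

End CliffordGenerators.

Lemma clifford_inj_matrix (K : fieldType) (m n : nat)
    (q : 'M[K]_(m, n) -> K) x :
  clifford_inj q x = \sum_(p : 'I_m * 'I_n)
    quot_scalar (clifford_rel q) (x p.1 p.2) *
    clifford_inj q (delta_mx p.1 p.2).
Proof.
rewrite [x in LHS]matrix_sum_delta pair_bigA /=.
rewrite (big_morph _ (clifford_injD q) (clifford_inj0 q)).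
apply: eq_bigr => p _.
by rewrite -[_ *: _ in LHS]addr0 clifford_inj_linear clifford_inj0 addr0.
Qed.

(** * Anti-automorphisms as ring morphisms to the converse ring *)

Section ConverseScalars.
Variables (K : fieldType) (B : pzRingType) (s : {rmorphism K -> B}).

(** The scalars as a morphism into [B^c], possible since K is commutative; the universal properties
    then produce anti-endomorphisms. *)
Definition converse_scalar (c : K) : B^c := s c.

Fact converse_scalar_is_zmod_morphism : zmod_morphism converse_scalar.
Proof. exact: (rmorphB s). Qed.
HB.instance Definition _ := GRing.isZmodMorphism.Build K B^c converse_scalar
  converse_scalar_is_zmod_morphism.

Fact converse_scalar_is_monoid_morphism : monoid_morphism converse_scalar.
Proof.
by split=> [|a b]; [apply: (rmorph1 s) | rewrite mulrC; apply: (rmorphM s)].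
Qed.
HB.instance Definition _ := GRing.isMonoidMorphism.Build K B^c converse_scalar
  converse_scalar_is_monoid_morphism.

Lemma converse_scalarC :
  (forall c y, GRing.comm (s c) y) ->
  forall c y, GRing.comm (converse_scalar c) y.
Proof. by move=> sC c y; apply/commr_sym/sC. Qed.

End ConverseScalars.

Lemma converse_comp (R R' : pzRingType) (f : {rmorphism R -> R'})
    (F : {rmorphism R -> R^c}) :
  exists G : {rmorphism R -> R'^c}, forall x, G x = f (F x).
Proof.
pose G x : R'^c := f (F x).
have G_zmod : zmod_morphism G.
  by move=> x y; rewrite /G rmorphB -[LHS]/(f ((F x : R) - F y)) rmorphB.
have G_monoid : monoid_morphism G.
  split=> [|x y]; first by rewrite /G rmorph1 -[LHS]/(f (1 : R)) rmorph1.
  by rewrite /G rmorphM -[LHS]/(f ((F y : R) * F x)) rmorphM.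
by exists (HB.pack G (GRing.isZmodMorphism.Build R R'^c G G_zmod)
  (GRing.isMonoidMorphism.Build R R'^c G G_monoid) : {rmorphism R -> R'^c}).
Qed.

(** Makes involutivity an equality of ring endomorphisms, which can be tested on generators. *)
Lemma converse_sqr (R : pzRingType) (F : {rmorphism R -> R^c}) :
  exists G : {rmorphism R -> R}, forall x, G x = F (F x).
Proof.
pose G x : R := F (F x).
have G_zmod : zmod_morphism G.
  by move=> x y; rewrite /G rmorphB -[LHS]/(F ((F x : R) - F y)) rmorphB.
have G_monoid : monoid_morphism G.
  split=> [|x y]; first by rewrite /G rmorph1 -[LHS]/(F (1 : R)) rmorph1.
  by rewrite /G rmorphM -[LHS]/(F ((F y : R) * F x)) rmorphM.
by exists (HB.pack G (GRing.isZmodMorphism.Build R R G G_zmod)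
  (GRing.isMonoidMorphism.Build R R G G_monoid) : {rmorphism R -> R}).
Qed.

Lemma quot_rmorphism_linear (K : fieldType) (A A' : algType K)
    (S : A -> Prop) (S' : A' -> Prop)
    (F : {rmorphism alg_quot S -> alg_quot S'}) :
  (forall c, F (quot_scalar S c) = quot_scalar S' c) -> linear F.
Proof. by move=> Fs c x y; rewrite !quot_scalarE rmorphD rmorphM Fs. Qed.

Lemma quot_converse_involution (K : fieldType) (A : algType K) (S : A -> Prop)
    (F : {rmorphism alg_quot S -> (alg_quot S)^c}) :
  (forall c, F (quot_scalar S c) = quot_scalar S c) ->
  (forall x, F (F x) = x) ->
  linear (F : alg_quot S -> alg_quot S) /\ @involution (alg_quot S) F.
Proof.
move=> Fs FF; split=> [c x y|]; last first.
  by split=> //; [exact: (rmorphD F) | exact: (rmorph1 F) | exact: (rmorphM F)].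
rewrite !quot_scalarE rmorphD rmorphM Fs; congr (_ + _).
exact/esym/quot_scalarC.
Qed.

(** Each [J i] reverses products in its factor, matching the reversed product of the converse ring,
    so the relations are respected. *)
Lemma tensor_involution_exists (K : fieldType) (I : finType)
    (A : I -> falgType K) (J : forall i, A i -> A i) :
  (forall i, involution (J i)) -> (forall i, first_kind (J i)) ->
  exists JT : {rmorphism tensor_prod A -> (tensor_prod A)^c},
    (forall c, JT (quot_scalar _ c) = quot_scalar _ c) /\
    tensor_involution J JT.
Proof.
move=> Jinv JK; pose sT : {rmorphism K -> tensor_prod A} :=
  quot_scalar (@tensor_prod_rel K I A).
pose h (x : family_of A) : (tensor_prod A)^c :=
  pure_tensor [ffun i => J i (x i)].
have JZ i c (x y : A i) : J i (c *: x + y) = c *: J i x + J i y.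
  have [JD _ JM _] := Jinv i.
  by rewrite JD -mulr_algl JM JK mulr_algr.
have [||||JT [JTs JTh]] :=
  @tensor_prod_lift K (tensor_prod A)^c (converse_scalar sT) _ I A h.
- exact/converse_scalarC/quot_scalarC.
- rewrite -[RHS](@pure_tensor1 K I A) /h; congr pure_tensor; apply/ffunP => i.
  by rewrite !ffunE; have [] := Jinv i.
- move=> x y; rewrite -[RHS]/((h y : tensor_prod A) * h x) -pure_tensorM.
  congr pure_tensor; apply/ffunP => i.
  by rewrite !ffunE; have [_ _ ->] := Jinv i.
- move=> i c x y z zi zj; rewrite [_ * _](converse_scalarC _ _ _).
    apply: (@pure_tensor_linear K I A i); first by rewrite !ffunE zi JZ.
    by move=> j /zj[zx zy]; rewrite !ffunE -zx -zy.
  exact/quot_scalarC.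
have JTK x : JT (JT x) = x.
  have [F FE] := converse_sqr JT; rewrite -FE.
  apply: (free_alg_quot_ext (G := idfun)) => [c|y] /=; rewrite FE ?JTs //.
  rewrite JTh [LHS]JTh; congr pure_tensor; apply/ffunP => i.
  by rewrite !ffunE; have [_ _ _ ->] := Jinv i.
exists JT; split=> //; have [JTl JTi] := quot_converse_involution JTs JTK.
by split.
Qed.

(** The Clifford relation involves only squares, so it survives reversal, and it survives [sigma]
    because q does. *)
Lemma clifford_involution_exists (K : fieldType) (V : vectType K) (q : V -> K)
    (sigma : V -> V) :
  linear sigma -> (forall x, q (sigma x) = q x) ->
  (forall x, sigma (sigma x) = x) ->
  exists JC : {rmorphism clifford_alg q -> (clifford_alg q)^c},
    (forall c, JC (quot_scalar _ c) = quot_scalar _ c) /\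
    clifford_involution sigma JC.
Proof.
move=> s_lin qs ss; pose sC : {rmorphism K -> clifford_alg q} :=
  quot_scalar (clifford_rel q).
pose h x : (clifford_alg q)^c := clifford_inj q (sigma x).
have [|||JC [JCs JCh]] :=
  @clifford_lift K (clifford_alg q)^c (converse_scalar sC) _ V q h.
- exact/converse_scalarC/quot_scalarC.
- move=> c x y.
  rewrite [_ * _](converse_scalarC _ _ _); last exact/quot_scalarC.
  by rewrite /h s_lin clifford_inj_linear.
- by move=> x; rewrite -(qs x); apply: clifford_inj_sqr.
have JCK x : JC (JC x) = x.
  have [F FE] := converse_sqr JC; rewrite -FE.
  apply: (clifford_ext (G := idfun)) => [c|y] /=; rewrite FE ?JCs //.
  by rewrite JCh [LHS]JCh /h ss.
exists JC; split=> //; have [JCl JCi] := quot_converse_involution JCs JCK.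
by split.
Qed.

(** * The isomorphism *)

Section DiagonalForms.
Variables (K : fieldType) (m n : nat) (d : 'I_m -> 'I_n -> K).
Hypothesis K2 : (2%:R : K) != 0.

Definition diag_form (x : 'M[K]_(m, n)) : K :=
  \sum_(p : 'I_m * 'I_n) d p.1 p.2 * x p.1 p.2 ^+ 2.

Lemma diag_form_polar x y : polar_form diag_form x y =
  \sum_(p : 'I_m * 'I_n) d p.1 p.2 * (x p.1 p.2 * y p.1 p.2).
Proof.
rewrite /polar_form /diag_form -!sumrB mulr_sumr; apply: eq_bigr => p _.
by rewrite !mxE; field.
Qed.

Lemma diag_form_quadratic : quadratic_form diag_form.
Proof.
split=> [c x|].
  rewrite /diag_form mulr_sumr; apply: eq_bigr => p _; rewrite mxE; ring.
split=> [y|x] c z t /=; rewrite !diag_form_polar mulr_sumr -big_split /=;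
  by apply: eq_bigr => p _; rewrite !mxE; ring.
Qed.

Lemma diag_form_delta t i : diag_form (delta_mx t i) = d t i.
Proof.
rewrite /diag_form (bigD1 (t, i)) //= big1 => [|[r j] ne_ti] /=.
  by rewrite mxE !eqxx expr1n mulr1 addr0.
by rewrite mxE -xpair_eqE (negPf ne_ti) expr0n mulr0.
Qed.

Lemma diag_form_deltaD t i r j : (t, i) != (r, j) ->
  diag_form (delta_mx t i + delta_mx r j) =
    diag_form (delta_mx t i) + diag_form (delta_mx r j).
Proof.
move=> ne_p; rewrite /diag_form -big_split; apply: eq_bigr => -[k l] _ /=.
rewrite !mxE -!xpair_eqE; have [->|_] := eqVneq (k, l) (t, i).
  by rewrite (negPf ne_p) mulr0n expr0n !(mulr0, addr0).
by rewrite mulr0n expr0n !(mulr0, add0r).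
Qed.

Variable e : 'I_m -> 'I_n -> bool.

Definition sign_symmetry (x : 'M[K]_(m, n)) : 'M[K]_(m, n) :=
  \matrix_(t, i) ((-1) ^+ e t i * x t i).

Lemma sign_symmetry_linear : linear sign_symmetry.
Proof. by move=> c x y; apply/matrixP => t i; rewrite !mxE; ring. Qed.

Lemma sign_symmetryK x : sign_symmetry (sign_symmetry x) = x.
Proof. by apply/matrixP => t i; rewrite !mxE signrMK. Qed.

Lemma diag_form_sign_symmetry x : diag_form (sign_symmetry x) = diag_form x.
Proof. by apply: eq_bigr => p _; rewrite mxE exprMn sqrr_sign mul1r. Qed.

Lemma sign_symmetry_orthogonal : orthogonal_symmetry diag_form sign_symmetry.
Proof.
split; [exact: sign_symmetry_linear | | exact: sign_symmetryK] => x y.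
rewrite /polar_form !diag_form_sign_symmetry.
have -> : sign_symmetry x + sign_symmetry y = sign_symmetry (x + y).
  by apply/matrixP => t i; rewrite !mxE mulrDr.
by rewrite diag_form_sign_symmetry.
Qed.

End DiagonalForms.

Lemma quat_system_anticomm (K : fieldType) (n : nat) (B : pzRingType)
    (s : {rmorphism K -> B}) c (G : 'I_2 -> 'I_n -> B) t i r j :
  quat_system s true c G -> (t, i) != (r, j) ->
  G t i * G r j = - (G r j * G t i).
Proof.
move=> [_ G10 Gne]; have [<-|ne_ij _] := eqVneq i j; last first.
  by rewrite Gne // mulN1r.
by case: (ord2P t) => ->; case: (ord2P r) => ->; rewrite ?eqxx // => _;
  rewrite G10 ?opprK.
Qed.

Lemma quat_system_comm (K : fieldType) (n : nat) (B : pzRingType)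
    (s : {rmorphism K -> B}) c (G : 'I_2 -> 'I_n -> B) t i r j :
  quat_system s false c G -> i != j -> GRing.comm (G t i) (G r j).
Proof. by move=> [_ _ Gne] ne_ij; rewrite /GRing.comm Gne // expr0 mul1r. Qed.

Section LinearCombinations.
Variables (K : fieldType) (m n : nat) (B : pzRingType) (s : {rmorphism K -> B}).
Hypothesis sC : forall c y, GRing.comm (s c) y.

Definition mx_comb (G : 'I_m -> 'I_n -> B) (x : 'M[K]_(m, n)) : B :=
  \sum_(p : 'I_m * 'I_n) s (x p.1 p.2) * G p.1 p.2.

Lemma mx_comb_linear G c x y :
  mx_comb G (c *: x + y) = s c * mx_comb G x + mx_comb G y.
Proof.
rewrite /mx_comb mulr_sumr -big_split; apply: eq_bigr => p _.
by rewrite !mxE rmorphD rmorphM mulrDl mulrA.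
Qed.

Lemma mx_comb_delta G t i : mx_comb G (delta_mx t i) = G t i.
Proof.
rewrite /mx_comb (bigD1 (t, i)) //= big1 => [|[r j] ne_p].
  by rewrite mxE !eqxx rmorph1 mul1r addr0.
by rewrite mxE -xpair_eqE (negPf ne_p) rmorph0 mul0r.
Qed.

Lemma mx_comb_sqr G (d : 'I_m -> 'I_n -> K) x :
  (forall t i, G t i * G t i = s (d t i)) ->
  (forall t i r j, (t, i) != (r, j) -> G t i * G r j = - (G r j * G t i)) ->
  mx_comb G x * mx_comb G x = s (diag_form d x).
Proof.
move=> Gsq Gac; rewrite /mx_comb.
rewrite sum_anticommuting_sqr ?index_enum_uniq // => [|[t i] [r j] ne_p].
  rewrite rmorph_sum; apply: eq_bigr => -[t i] _ /=.
  by rewrite (scalar_mulACA sC) Gsq -rmorphM mulrC expr2.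
by rewrite /= !(scalar_mulACA sC) Gac // mulrN [x t i * _]mulrC.
Qed.

(** This is where signs of eigenvectors in the algebra become the diagonal entries of a symmetry of
    V. *)
Lemma mx_comb_converse (F : {rmorphism B -> B^c}) G
    (e : 'I_m -> 'I_n -> bool) x :
  (forall c, F (s c) = s c) ->
  (forall t i, F (G t i) = (-1) ^+ e t i * G t i :> B) ->
  F (mx_comb G x) = mx_comb G (sign_symmetry e x).
Proof.
move=> Fs FG; rewrite rmorph_sum; apply: eq_bigr => p _.
rewrite rmorphM -[LHS]/((F (G p.1 p.2) : B) * F (s (x p.1 p.2))) FG Fs.
by rewrite mxE rmorphM rmorph_sign -!mulrA -sC.
Qed.

End LinearCombinations.

Lemma mx_comb_morph (K : fieldType) (m n : nat) (B B' : pzRingType)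
    (s : {rmorphism K -> B}) (s' : {rmorphism K -> B'})
    (F : {rmorphism B -> B'}) (G : 'I_m -> 'I_n -> B)
    (G' : 'I_m -> 'I_n -> B') x :
  (forall c, F (s c) = s' c) -> (forall t i, F (G t i) = G' t i) ->
  F (mx_comb s G x) = mx_comb s' G' x.
Proof.
move=> Fs FG; rewrite rmorph_sum; apply: eq_bigr => p _.
by rewrite rmorphM Fs FG.
Qed.

Section Isomorphism.
Variables (K : fieldType) (n : nat) (Q : 'I_n -> falgType K).
Variable J : forall i : 'I_n, Q i -> Q i.
Arguments J : clear implicits.
Hypothesis K2 : (2%:R : K) != 0.
Hypothesis Jinv : forall i, involution (J i).
Hypothesis JK : forall i, first_kind (J i).
Variables (a b : 'I_n -> K) (u v : forall i, Q i).
Hypothesis uvP : forall i, quat_pair (a i) (b i) (u i) (v i).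
Hypothesis uv_basis : forall i, basis_of fullv [:: 1; u i; v i; u i * v i].
Hypothesis Ju : forall i, exists e : bool, J i (u i) = (-1) ^+ e * u i.
Hypothesis Jv : forall i, exists e : bool, J i (v i) = (-1) ^+ e * v i.

Let c (t : 'I_2) (i : 'I_n) : K := if t == 0 then a i else b i.
Let gen (t : 'I_2) (i : 'I_n) : Q i := if t == 0 then u i else v i.
Let one (i : 'I_n) : K := 1.
Let z := twist_sqr one c.
(** Scalars of the return twist: [z i] is the square of the prefix in the tensor product. *)
Let zV i := (z i)^-1.
(** The squares of the [ET t i], spelled as in [twist_system] so that [ET_system] is an instance of
    it. *)
Let d (t : 'I_2) (i : 'I_n) : K := one i ^+ 2 * z i * c t i.
Let q := diag_form d.

Local Notation T := (tensor_prod Q).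
Local Notation C := (clifford_alg q).
Local Notation sT := (quot_scalar (@tensor_prod_rel K 'I_n Q)).
Local Notation sC := (quot_scalar (clifford_rel q)).

Let scT c y : GRing.comm (sT c) y := quot_scalarC c y.
Let scC c y : GRing.comm (sC c) y := quot_scalarC c y.

Let GT (t : 'I_2) i : T := tensor_factor (gen t i).
Let ET := twist sT one one GT.
Let EC (t : 'I_2) (i : 'I_n) : C := clifford_inj q (delta_mx t i).
Let GC := twist sC zV zV EC.

Let c_neq0 t i : c t i != 0.
Proof. by rewrite /c; have [? ? _ _ _] := uvP i; case: ifP. Qed.

Let z_neq0 i : z i != 0.
Proof.
apply/prodf_neq0 => j _; rewrite oppr_eq0 expr1n mul1r.
by rewrite mulf_neq0 ?c_neq0.
Qed.

Let GT_system : quat_system sT false c GT.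
Proof.
split=> [t i|i|t r i j ne_ij].
- rewrite -[LHS]rmorphM -[RHS](@tensor_factor_scalar _ _ Q i).
  congr (tensor_factor _); rewrite /gen /c.
  by have [_ _ uu vv _] := uvP i; case: ifP.
- have [_ _ _ _ vu] := uvP i.
  by rewrite -[LHS]rmorphM -[X in _ = - X]rmorphM -[RHS]rmorphN -vu.
- rewrite expr0 mul1r; exact: tensor_factorC.
Qed.

Let ET_system : quat_system sT true d ET.
Proof. by have := twist_system scT one GT_system one. Qed.

Let EC_system : quat_system sC true d EC.
Proof.
have EC_ac t i r j : (t, i) != (r, j) -> EC t i * EC r j = - (EC r j * EC t i).
  by move=> ne_p; apply/clifford_inj_anticomm/diag_form_deltaD.
split=> [t i|i|t r i j ne_ij].
- by rewrite /EC clifford_inj_sqr /q diag_form_delta.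
- exact: EC_ac.
- by rewrite mulN1r; apply: EC_ac; rewrite xpair_eqE negb_and ne_ij orbT.
Qed.

(** In each factor the two copies of [z j] from [d 0 j * d 1 j] cancel against the square of [zV j],
    so prefixes have the same square in both algebras. *)
Let twist_sqr_d i : twist_sqr zV d i = z i.
Proof.
apply: eq_bigr => j _; rewrite /d /zV /one; field; exact: z_neq0.
Qed.

Let GC_system : quat_system sC false c GC.
Proof.
have [GCsq GC10 GCne] := twist_system scC zV EC_system zV.
split=> [t i|//|//]; rewrite [LHS]GCsq; congr (sC _).
by rewrite twist_sqr_d /d /zV /one; field; apply: z_neq0.
Qed.

Let ET_K t i : twist sT zV zV ET t i = GT t i.
Proof.
apply: (twistK scT GT_system) => j; rewrite /zV /one -/(z j);
  by rewrite ?expr1n ?mul1r ?mulr1; apply: mulVf.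
Qed.

Let EC_K t i : twist sC one one GC t i = EC t i.
Proof.
apply: (twistK scC EC_system) => j; rewrite twist_sqr_d /zV /one.
  by field; apply: z_neq0.
by rewrite mul1r mulVf.
Qed.

(** [GC] satisfies the relations of the generators of the [Q i], with the same squares [c], and its
    pairs commute with one another. *)
Let tensor_to_clifford : exists g : {rmorphism T -> C},
  [/\ forall x, g (sT x) = sC x & forall t i, g (GT t i) = GC t i].
Proof.
have [GCsq GC10 GCne] := GC_system.
have /(_ _)/cid-/all_sig[G GP] i : exists F : {rmorphism Q i -> C},
    [/\ forall x, F x%:A = sC x, F (u i) = GC 0 i & F (v i) = GC 1 i].
  exact: (quat_lift K2 (uvP i) (uv_basis i) scC (GCsq 0 i) (GCsq 1 i) (GC10 i)).
have G_gen t i : G i (gen t i) = GC t i.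
  have [_ Gu Gv] := GP i.
  by rewrite /gen; case: (ord2P t) => ->; [exact: Gu | exact: Gv].
have G_scalar i x : G i x%:A = sC x by have [] := GP i.
have GC_comm t i r j : i != j -> GRing.comm (GC t i) (GC r j).
  exact: (quat_system_comm _ _ GC_system).
have G_comm1 t i j y : i != j -> GRing.comm (GC t i) (G j y).
  move=> ne_ij; apply: (quat_rmorphism_comm (uv_basis j)) => [x||].
  - by rewrite G_scalar; apply/commr_sym/scC.
  - by rewrite -[u j]/(gen 0 j) G_gen; apply: GC_comm.
  - by rewrite -[v j]/(gen 1 j) G_gen; apply: GC_comm.
have G_comm i j x y : i != j -> GRing.comm (G i x) (G j y).
  move=> ne_ij; apply/commr_sym/(quat_rmorphism_comm (uv_basis i)) => [w||].
  - by rewrite G_scalar; apply/commr_sym/scC.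
  - by rewrite -[u i]/(gen 0 i) G_gen; apply/commr_sym/G_comm1.
  - by rewrite -[v i]/(gen 1 i) G_gen; apply/commr_sym/G_comm1.
have [g [gs gG]] := tensor_prod_comm_lift scC G_scalar G_comm.
exists g; split; first exact: gs.
move=> t i; apply: etrans (gG i (gen t i)) _; exact: G_gen.
Qed.

Let clifford_to_tensor : exists f : {rmorphism C -> T},
  (forall x, f (sC x) = sT x) /\
  (forall x, f (clifford_inj q x) = mx_comb sT ET x).
Proof.
apply: (clifford_lift scT) => [k x y|x]; first exact: mx_comb_linear.
have [ETsq _ _] := ET_system.
apply: (mx_comb_sqr scT) => [|t i r j ne_p]; first exact: ETsq.
exact: (quat_system_anticomm ET_system).
Qed.

Let JT_ET (JT : {rmorphism T -> T^c}) :
  (forall k, JT (sT k) = sT k) -> tensor_involution J JT ->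
  forall t i, exists e : bool, JT (ET t i) = (-1) ^+ e * ET t i :> T.
Proof.
move=> JTs [_ _ JTh] t i.
have JTf j (x : Q j) : JT (tensor_factor x) = tensor_factor (J j x) :> T.
  rewrite [LHS]JTh; congr (pure_tensor _); apply/ffunP => k; rewrite !ffunE.
  have [<-|ne_jk] := eqVneq j k; first by rewrite !dfwith_in.
  by rewrite !dfwith_out //; have [] := Jinv k.
apply: (@twist_conv K n T sT JT false c one one GT scT GT_system JTs) => r j.
have [e Je] : exists e : bool, J j (gen r j) = (-1) ^+ e * gen r j.
  by rewrite /gen; case: ifP.
exists e; apply: etrans (JTf j _) _; rewrite Je.
by apply: etrans (rmorphM _ _ _) _; rewrite rmorph_sign.
Qed.

Lemma clifford_tensor_isomorphism :
  exists (V : vectType K) (q : V -> K) (sigma : V -> V),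
    [/\ quadratic_form q, \dim {: V} = (2 * n)%N, orthogonal_symmetry q sigma
      & exists (JC : clifford_alg q -> clifford_alg q)
               (JT : tensor_prod Q -> tensor_prod Q),
          [/\ clifford_involution sigma JC, tensor_involution J JT
            & exists f : clifford_alg q -> tensor_prod Q,
                [/\ linear f, monoid_morphism f, bijective f
                  & forall u, f (JC u) = JT (f u)]]].
Proof.
have [g [gs gG]] := tensor_to_clifford.
have [f [fs fE]] := clifford_to_tensor.
have f_EC t i : f (EC t i) = ET t i.
  by apply: etrans (fE _) _; apply: mx_comb_delta.
(* On V the composite twists [EC] twice, which is undone by [EC_K]. *)
have fK x : g (f x) = x.
  apply: (clifford_ext (F := g \o f) (G := idfun)) x => [k|x] /=.
    by rewrite fs gs.
  rewrite fE (mx_comb_morph _ gs (twist_morph one one gs gG)).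
  rewrite [RHS]clifford_inj_matrix; apply: eq_bigr => p _.
  by congr (_ * _); apply: EC_K.
(* Pure tensors are products of elements of the factors, so it suffices to test the generators of
   each [Q i], where [ET_K] applies. *)
have gK x : f (g x) = x.
  have fg_factor i (y : Q i) : f (g (tensor_factor y)) = tensor_factor y.
    pose F : {rmorphism Q i -> T} := f \o (g \o tensor_factor (i := i)).
    apply: (quat_rmorphism_ext (F := F) (G := tensor_factor (i := i))
      (uv_basis i)).
    - by move=> k; rewrite /= tensor_factor_scalar gs fs.
    - rewrite /= -[tensor_factor (u i)]/(GT 0 i) gG.
      by rewrite (twist_morph zV zV fs f_EC) ET_K.
    - rewrite /= -[tensor_factor (v i)]/(GT 1 i) gG.
      by rewrite (twist_morph zV zV fs f_EC) ET_K.
  apply: (free_alg_quot_ext (F := f \o g) (G := idfun)) x => [k|x] /=.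
    by rewrite gs fs.
  rewrite -[to_quot _ _]/(pure_tensor x) pure_tensor_prod !rmorph_prod.
  by apply: eq_bigr => i _; apply: fg_factor.
have [JT [JTs JTinv]] := tensor_involution_exists Jinv JK.
(* The symmetry of V is read off from the tensor involution: basis vectors receive the eigenvalues
   of the [ET t i]. *)
pose e t i := projT1 (cid (JT_ET JTs JTinv t i)).
have JT_E t i : JT (ET t i) = (-1) ^+ e t i * ET t i :> T.
  exact: projT2 (cid (JT_ET JTs JTinv t i)).
have [JC [JCs JCinv]] := clifford_involution_exists (sign_symmetry_linear e)
  (diag_form_sign_symmetry d e) (sign_symmetryK e).
exists 'M[K]_(2, n), q, (sign_symmetry e); split.
- exact: diag_form_quadratic.
- by rewrite dimvf dim_matrix.
- exact: sign_symmetry_orthogonal.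
exists JC, JT; split=> //; exists f; split.
- exact: quot_rmorphism_linear.
- by split; [apply: rmorph1 | apply: rmorphM].
- by exists g.
(* Both sides are ring morphisms from C to the converse of T, hence are compared on V only. *)
have [F FE] := converse_comp f JC; move=> x; rewrite -FE.
apply: (clifford_ext (F := F) (G := JT \o f)) x => [k|x].
  by rewrite FE JCs /= fs JTs.
rewrite FE; have [_ _ ->] := JCinv; rewrite /= !fE.
by rewrite (mx_comb_converse scT _ JTs JT_E).
Qed.

End Isomorphism.

Theorem theorem6p3 (K : fieldType) (n : nat) (Q : 'I_n -> falgType K)
    (J : forall i : 'I_n, Q i -> Q i) :
  2%N \notin [pchar K] -> (1 <= n)%N ->
  (forall i, quaternion_algebra (Q i)) ->
  (forall i, involution (J i)) ->
  (forall i, first_kind (J i)) ->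
  exists (V : vectType K) (q : V -> K) (sigma : V -> V),
    [/\ quadratic_form q, \dim {: V} = (2 * n)%N, orthogonal_symmetry q sigma
      & exists (JC : clifford_alg q -> clifford_alg q)
               (JT : tensor_prod Q -> tensor_prod Q),
          [/\ clifford_involution sigma JC, tensor_involution J JT
            & exists f : clifford_alg q -> tensor_prod Q,
                [/\ linear f, monoid_morphism f, bijective f
                  & forall u, f (JC u) = JT (f u)]]].
Proof.
move=> pK _ Qquat Jinv JK.
have K2 : (2%:R : K) != 0 by move: pK; rewrite inE.
have /(_ _)/cid-/all_sig[p pP] i : exists p : (K * K * Q i * Q i)%type,
    [/\ quat_pair p.1.1.1 p.1.1.2 p.1.2 p.2,
      basis_of fullv [:: 1; p.1.2; p.2; p.1.2 * p.2],
      exists e : bool, J i p.1.2 = (-1) ^+ e * p.1.2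
    & exists e : bool, J i p.2 = (-1) ^+ e * p.2].
  have [a [b [u [v uvP]]]] :=
    quat_eigen_generators K2 (Qquat i) (Jinv i) (JK i).
  by exists (a, b, u, v).
apply: (clifford_tensor_isomorphism K2 Jinv JK (a := fun i => (p i).1.1.1)
  (b := fun i => (p i).1.1.2) (u := fun i => (p i).1.2)
  (v := fun i => (p i).2)) => i;
  by have [] := pP i.
Qed.
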